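(* Let $t$ be a fixed non-negative integer. There is an algorithm that, given an interval graph $G$ and a threshold function $\tau$ for $G$ with $\tau(u)\leq t$ for every vertex $u$ of $G$, determines the value ${\rm dyn}(G,\tau)$ in time polynomial in the order of $G$.
   Context: All graphs are finite, simple and undirected. An interval graph is a graph whose vertices can be assigned intervals of the real line so that two distinct vertices are adjacent if and only if their intervals intersect. A threshold function for a graph $G$ is an integer-valued function whose domain contains the vertex set $V(G)$. For a set $D\subseteq V(G)$, the hull $H_{(G,\tau)}(D)$ is the set obtained by starting with the empty set and iteratively adding to the current set vertices $u$ that belong to $D$ or have at least $\tau(u)$ neighbors in the current set, as long as possible. $D$ is a dynamic monopoly of $(G,\tau)$ if $H_{(G,\tau)}(D)=V(G)$, and ${\rm dyn}(G,\tau)$ denotes the minimum order of a dynamic monopoly of $(G,\tau)$. *)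

(* Defs.v *)
From HB Require Import structures.
From mathcomp Require Import all_boot all_order all_algebra.
From Stdlib Require Rdefinitions.
Set Implicit Arguments. Unset Strict Implicit. Unset Printing Implicit Defensive.
Import Order.TTheory GRing.Theory Num.Theory.

Definition simple_graph (T : finType) (e : rel T) : Prop :=
  symmetric e /\ irreflexive e.

Definition interval_graph (T : finType) (e : rel T) : Prop :=
  exists l r : T -> Rdefinitions.R,
    (forall x, Rdefinitions.Rle (l x) (r x)) /\
    (forall x y, x != y -> (e x y <-> (Rdefinitions.Rle (l x) (r y) /\ Rdefinitions.Rle (l y) (r x)))).

Definition nbhd (T : finType) (e : rel T) (u : T) : {set T} := [set v | e u v].

Definition hull_step (T : finType) (e : rel T) (tau : T -> int) (D S : {set T})
  : {set T} :=
  S :|: [set u | (u \in D) || (tau u <= (#|nbhd e u :&: S|)%:Z)%R].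

(* The hull H_(G,tau)(D): start from the empty set and add vertices as  *)
(* long as possible.  The process is monotone, so adding in rounds      *)
(* gives the same (unique) final set, which is reached after at most    *)
(* #|T| rounds.                                                         *)
Definition hull (T : finType) (e : rel T) (tau : T -> int) (D : {set T})
  : {set T} :=
  iter #|T| (hull_step e tau D) set0.

Definition dyn_monopoly (T : finType) (e : rel T) (tau : T -> int) (D : {set T})
  : bool := hull e tau D == [set: T].

(* dyn(G,tau): the minimum order of a dynamic monopoly (V(G) itself is  *)
(* always one, so the arg min is well defined).                          *)
Definition dyn (T : finType) (e : rel T) (tau : T -> int) : nat :=
  #|[arg min_(D < [set: T] | dyn_monopoly e tau D) #|D|]|.

(* Model of computation: a unit-cost integer RAM with indirect          *)
(* addressing, addition and subtraction (no multiplication), which is   *)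
(* polynomially equivalent to Turing machines.                          *)
Inductive instr :=
| IConst of nat & int        (* M[d] := c                       *)
| IAdd   of nat & nat & nat  (* M[d] := M[a] + M[b]             *)
| ISub   of nat & nat & nat  (* M[d] := M[a] - M[b]             *)
| ILoad  of nat & nat        (* M[d] := M[|M[a]|]               *)
| IStore of nat & nat        (* M[|M[a]|] := M[s]               *)
| IJz    of nat & nat        (* if M[a] = 0 then goto k         *)
| IJneg  of nat & nat        (* if M[a] < 0 then goto k         *)
| IHalt.

Definition memory := nat -> int.

Definition upd (m : memory) (d : nat) (v : int) : memory :=
  fun x => if x == d then v else m x.

(* One step; None means the machine has halted (Halt instruction or    *)
(* program counter out of range). *)
Definition ram_step (p : seq instr) (pc : nat) (m : memory)
  : option (nat * memory) :=
  match nth IHalt p pc with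
  | IConst d c => Some (pc.+1, upd m d c)
  | IAdd d a b => Some (pc.+1, upd m d (m a + m b)%R)
  | ISub d a b => Some (pc.+1, upd m d (m a - m b)%R)
  | ILoad d a => Some (pc.+1, upd m d (m (absz (m a))))
  | IStore a s => Some (pc.+1, upd m (absz (m a)) (m s))
  | IJz a k => Some (if m a == 0%R then k else pc.+1, m)
  | IJneg a k => Some (if (m a < 0)%R then k else pc.+1, m)
  | IHalt => None
  end.

Fixpoint run (p : seq instr) (fuel : nat) (pc : nat) (m : memory) : option int :=
  match ram_step p pc m with
  | None => Some (m 0)
  | Some (pc', m') =>
      match fuel with
      | 0 => None
      | f.+1 => run p f pc' m'
      end
  end.

(* Input encoding of (G, tau) with V(G) = 'I_n:                          *)
(*   M[0] = n, M[1 + i*n + j] = [ij is an edge], M[1 + n*n + i] = tau(i),*)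
(*   all other registers 0.                                              *)
Definition encode (n : nat) (e : rel 'I_n) (tau : 'I_n -> int) : memory :=
  fun x =>
    if x == 0 then (n%:Z)%R
    else if x <= n * n then
      (let k := x.-1 in
       match insub (k %/ n), insub (k %% n) with
       | Some i, Some j => ((e i j : nat)%:Z)%R
       | _, _ => 0%R
       end)
    else if x <= n * n + n then
      (match insub (x.-1 - n * n) with
       | Some i => tau i
       | None => 0%R
       end)
    else 0%R.

(* Main.v *)
From Stdlib Require RIneq FunctionalExtensionality.
Require Import Defs.
From mathcomp Require Import all_boot all_order all_algebra.
From mathcomp Require Import zify.
Set Implicit Arguments. Unset Strict Implicit. Unset Printing Implicit Defensive.
Import Order.TTheory GRing.Theory Num.Theory.

(** An interval graph has a perfect elimination ordering: the interval with the
    leftmost right end is simplicial. Hence simplicial vertices can be removed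
    greedily, and no interval representation is ever computed. Let [K v] be the
    clique of later neighbours of [v], and let the parent of [v] be the first
    vertex of [K v]; the bags [B v = v + K v] form a tree decomposition.

    A set [D] is a dynamic monopoly iff the vertices outside [D] can be ordered
    in time so that each [u] is preceded by [tau u] neighbours. Since thresholds
    are at most [t], a vertex preceded by [t] members of some clique containing it
    needs no further attention. So in each bag only the first [t+1] vertices
    matter, together with, for the [p]-th of them, the number (at most [t - p])
    of its neighbours below the bag that precede it. Orders of two subtrees that
    meet in a bag can always be merged: the vertices of the bag that come after
    its first [t] may be moved right behind these. This gives a dynamic program
    over [n ^ O(t)] states.

    On the machine side, all these data are cells of one table indexed by tuples
    over a range [N = n + O(t)], filled in lexicographic order, each cell being a
    first-order condition on the previous ones. Such conditions are evaluated by
    nested loops in polynomial time. *)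

(** * Structured programs *)

(** The merging of orders is never carried out. A set is a dynamic monopoly iff its only closed
    superset is the whole vertex set, so soundness attaches to each cell a statement about all
    closed supersets of some witness; such statements combine over subtrees without any scheduling.
    Only completeness uses a time order, the one of an optimal monopoly, from which every entry is
    read off. On the machine side a formula is an ordinary boolean function, and its code exists
    only inside an existential; correctness and running time are thus handled apart. A cell is
    evaluated on the table cut off just before it, so the recursion is sound exactly when all
    references go to lexicographically smaller tuples. This dictates the leading tag: the
    elimination, then the relabelled graph, then the dynamic program. The range [n + (t + 5)] has
    room for the blank value [n], for costs up to [n], for counts up to [t], and for the tags even
    if [n = t = 0]. *)

Inductive test := TZ of nat | TN of nat.

Definition testb (b : test) (m : memory) : bool :=
  match b with TZ a => m a == 0%R | TN a => (m a < 0)%R end.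

Definition jump (b : test) (k : nat) : instr :=
  match b with TZ a => IJz a k | TN a => IJneg a k end.

Inductive cmd :=
| Block of seq instr
| Seq of cmd & cmd
| If of test & cmd & cmd
| While of test & cmd.

Definition eff (m : memory) (i : instr) : memory :=
  match i with
  | IConst d c => upd m d c
  | IAdd d a b => upd m d (m a + m b)%R
  | ISub d a b => upd m d (m a - m b)%R
  | ILoad d a => upd m d (m (absz (m a)))
  | IStore a s => upd m (absz (m a)) (m s)
  | _ => m
  end.

Definition straight (i : instr) : bool :=
  match i with IJz _ _ | IJneg _ _ | IHalt => false | _ => true end.

(* Register 1 is clobbered by every unconditional jump: the machine has none,
   so a jump is compiled as [M[1] := 0; if M[1] = 0 goto k]. *)
Fixpoint compile (o : nat) (c : cmd) : seq instr :=
  match c with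
  | Block s => s
  | Seq c1 c2 => let p1 := compile o c1 in p1 ++ compile (o + size p1) c2
  | If b c1 c2 =>
      let p2 := compile o.+1 c2 in
      let o1 := o.+1 + size p2 + 2 in
      let p1 := compile o1 c1 in
      jump b o1 :: p2 ++ [:: IConst 1 0%R; IJz 1 (o1 + size p1)] ++ p1
  | While b c1 =>
      let p1 := compile (o + 3) c1 in
      [:: jump b (o + 3); IConst 1 0%R; IJz 1 (o + 3 + size p1 + 2)]
        ++ p1 ++ [:: IConst 1 0%R; IJz 1 o]
  end.

(** The number is the exact count of machine steps, which makes [exec_run] an equation between runs.
    The compiled conditional puts the false branch first, so only that branch ends with a jump: it
    costs two more steps and resets register 1. *)
Inductive exec : cmd -> memory -> nat -> memory -> Prop :=
| exec_block s m : all straight s -> exec (Block s) m (size s) (foldl eff m s)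
| exec_seq c1 c2 m k1 m1 k2 m2 :
    exec c1 m k1 m1 -> exec c2 m1 k2 m2 -> exec (Seq c1 c2) m (k1 + k2) m2
| exec_if_true b c1 c2 m k m1 :
    testb b m -> exec c1 m k m1 -> exec (If b c1 c2) m k.+1 m1
| exec_if_false b c1 c2 m k m1 :
    ~~ testb b m -> exec c2 m k m1 -> exec (If b c1 c2) m (k + 3) (upd m1 1 0%R)
| exec_while_false b c m : ~~ testb b m -> exec (While b c) m 3 (upd m 1 0%R)
| exec_while_true b c m k1 m1 k2 m2 :
    testb b m -> exec c m k1 m1 -> exec (While b c) (upd m1 1 0%R) k2 m2 ->
    exec (While b c) m (k1 + 3 + k2) m2.

Lemma run_straight p f pc m i :
  nth IHalt p pc = i -> straight i -> run p f.+1 pc m = run p f pc.+1 (eff m i).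
Proof. by rewrite /= /ram_step => ->; case: i. Qed.

Lemma run_jump p f pc m b k :
  nth IHalt p pc = jump b k ->
  run p f.+1 pc m = run p f (if testb b m then k else pc.+1) m.
Proof. by rewrite /= /ram_step => ->; case: b. Qed.

Lemma run_goto p f pc m k :
  nth IHalt p pc = IConst 1 0%R -> nth IHalt p pc.+1 = IJz 1 k ->
  run p f.+2 pc m = run p f k (upd m 1 0%R).
Proof.
by move=> h1 h2; rewrite (run_straight _ _ h1) // (@run_jump _ _ _ _ (TZ 1) _ h2).
Qed.

Definition code_at (p : seq instr) (o : nat) (q : seq instr) : Prop :=
  forall i, i < size q -> nth IHalt p (o + i) = nth IHalt q i.

Lemma code_at_cat p o q1 q2 :
  code_at p o (q1 ++ q2) -> code_at p o q1 /\ code_at p (o + size q1) q2.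
Proof.
move=> h; split=> i hi.
  by rewrite h ?size_cat ?(ltn_addr _ hi) // nth_cat hi.
by rewrite -addnA h ?size_cat ?ltn_add2l // nth_cat ltnNge leq_addr addKn.
Qed.

Lemma code_at_cons p o i q :
  code_at p o (i :: q) -> nth IHalt p o = i /\ code_at p o.+1 q.
Proof.
move=> h; split; first by have := h 0 isT; rewrite addn0.
by move=> j hj; rewrite addSnnS h.
Qed.

Lemma exec_run c m k m' : exec c m k m' -> forall p o f,
  code_at p o (compile o c) ->
  run p (k + f) o m = run p f (o + size (compile o c)) m'.
Proof.
elim=> {c m k m'}.
- move=> s m; elim: s m => [|i s IH] m hs p o f h; first by rewrite addn0.
  case/andP: hs => hi hs; case: (code_at_cons h) => h1 h2.
  have -> : size (i :: s) + f = (size s + f).+1 by [].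
  by rewrite (run_straight _ _ h1) // (IH _ hs _ _ _ h2) /= addSnnS.
- move=> c1 c2 m k1 m1 k2 m2 _ IH1 _ IH2 p o f /code_at_cat[h1 h2].
  by rewrite -addnA (IH1 _ _ _ h1) (IH2 _ _ _ h2) /= size_cat addnA.
- move=> b c1 c2 m k m1 hb _ IH p o f; rewrite [compile o _]/=.
  case/code_at_cons=> h0 /code_at_cat[_ /code_at_cons[_ /code_at_cons[_]]].
  rewrite -[(_ + _).+2]addn2 => h4.
  rewrite addSn (run_jump _ _ h0) hb (IH _ _ _ h4) /= size_cat /=.
  by congr run; lia.
- move=> b c1 c2 m k m1 hb _ IH p o f; rewrite [compile o _]/=.
  case/code_at_cons=> h0 /code_at_cat[h1 /code_at_cons[h2 /code_at_cons[h3 _]]].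
  have -> : k + 3 + f = (k + f.+2).+1 by lia.
  rewrite (run_jump _ _ h0) (negbTE hb) (IH _ _ _ h1) (run_goto _ _ h2 h3) /= size_cat /=.
  by congr run; lia.
- move=> b c m hb p o f; rewrite [compile o _]/=.
  case/code_at_cons=> h0 /code_at_cons[h1 /code_at_cons[h2 _]].
  rewrite (run_jump _ _ h0) (negbTE hb) (run_goto _ _ h1 h2) /= size_cat /=.
  by congr run; lia.
- move=> b c m k1 m1 k2 m2 hb _ IH1 _ IH2 p o f h.
  case: (code_at_cat h) => /code_at_cons[h0 _] /code_at_cat[h1 /code_at_cons[h2 /code_at_cons[h3 _]]].
  have -> : k1 + 3 + k2 + f = (k1 + (k2 + f).+2).+1 by lia.
  by rewrite (run_jump _ _ h0) hb (IH1 _ _ _ h1) (run_goto _ _ h2 h3) IH2.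
Qed.

Lemma exec_run_whole c m k m' f :
  exec c m k m' -> k <= f -> run (compile 0 c) f 0 m = Some (m' 0).
Proof.
move=> h le_kf; have -> : f = k + (f - k) by lia.
rewrite (exec_run h) //; set p := compile 0 c.
(* Falling off the end of the code halts, and [run] tests this before the fuel, so no spare step is
   needed. *)
by case: (f - k) => [|g] /=; rewrite /ram_step nth_default.
Qed.

(** A total-correctness triple with a time bound. The start is one concrete memory rather than a
    precondition, so that [Q] may compare the final memory with it. *)
Definition runs (c : cmd) (m : memory) (K : nat) (Q : memory -> Prop) : Prop :=
  exists m' k, [/\ exec c m k m', k <= K & Q m'].

Lemma runs_block s m K Q :
  all straight s -> size s <= K -> Q (foldl eff m s) -> runs (Block s) m K Q.
Proof. by move=> hs hK hQ; exists (foldl eff m s), (size s); split=> //; constructor. Qed.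

Lemma runs_seq c1 c2 m K1 K2 K (Q : memory -> Prop) :
  runs c1 m K1 (fun m1 => runs c2 m1 K2 Q) -> K1 + K2 <= K ->
  runs (Seq c1 c2) m K Q.
Proof.
move=> [m1 [k1 [h1 le1 [m2 [k2 [h2 le2 hQ]]]]]] hK.
exists m2, (k1 + k2); split=> //; first exact: exec_seq h1 h2.
by apply: leq_trans hK; rewrite leq_add.
Qed.

Lemma runs_if b c1 c2 m K K' (Q : memory -> Prop) :
  (testb b m -> runs c1 m K Q) ->
  (~~ testb b m -> runs c2 m K (fun m' => Q (upd m' 1 0%R))) ->
  K + 3 <= K' -> runs (If b c1 c2) m K' Q.
Proof.
move=> h1 h2 hK; case: (boolP (testb b m)) => hb.
  have [m1 [k [h le hQ]]] := h1 hb.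
  by exists m1, k.+1; split=> //; [exact: exec_if_true | lia].
have [m1 [k [h le hQ]]] := h2 hb.
by exists (upd m1 1 0%R), (k + 3); split=> //; [exact: exec_if_false | lia].
Qed.

Lemma runs_weaken c m K K' (Q Q' : memory -> Prop) :
  runs c m K Q -> K <= K' -> (forall m', Q m' -> Q' m') -> runs c m K' Q'.
Proof.
move=> [m1 [k [h le hQ]]] hK hQQ; exists m1, k; split=> //; last exact: hQQ.
exact: leq_trans le hK.
Qed.

(* Fixed registers: 0 holds n, 1 is the jump scratch, 2 the loop test, 3 the
   result of a predicate, 4 the constant 1, 5 the range N of the quantifiers,
   6, 7 and 8 the base addresses of the edges, the thresholds and the table,
   9 the next table cell, 10 the output. Variable [i] lives in register
   [12 + 2 * i]; register [13 + 2 * i] is the flag of the loop on it. *)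
Notation rTest := 2.
Notation rRes := 3.
Notation rOne := 4.
Notation rN := 5.
Notation rEdge := 6.
Notation rTau := 7.
Notation rTab := 8.
Notation rPtr := 9.
Notation rOut := 10.
Definition rVar (i : nat) : nat := 12 + 2 * i.

Definition For (x b : nat) (c : cmd) : cmd :=
  Seq (Block [:: IConst x 0%R; ISub rTest x b])
    (While (TN rTest) (Seq c (Block [:: IAdd x x rOne; ISub rTest x b]))).

(** A round costs the body, two instructions for counter and test, and three for the jumps; five
    more pay for initialisation and exit. The invariant may not depend on the counter, the jump
    scratch or the test register, which the loop itself changes. *)
Lemma runs_for x b c m B K (I : nat -> memory -> Prop) :
  11 < x -> b != x -> b != 1 -> b != rTest ->
  (forall i m m', (forall a, a != x -> a != 1 -> a != rTest -> m' a = m a) ->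
     I i m -> I i m') ->
  (forall i m, I i m -> m b = Posz B /\ m rOne = 1%R) ->
  (forall i m, i < B -> I i m -> m x = Posz i ->
     runs c m K (fun m' => I i.+1 m' /\ m' x = Posz i)) ->
  I 0 m ->
  runs (For x b c) m (B * (K + 5) + 5) (fun m' => I B m').
Proof.
move=> x11 bx b1 bt Iext Ireg Ibody I0.
suff loop : forall j i m, j = B - i -> i <= B -> I i m -> m x = Posz i ->
    m rTest = (Posz i - Posz B)%R ->
    runs (While (TN rTest) (Seq c (Block [:: IAdd x x rOne; ISub rTest x b]))) m
      (j * (K + 5) + 3) (fun m' => I B m').
  apply: (@runs_seq _ _ _ 2 (B * (K + 5) + 3)); last by lia.
  have [hb h1] := Ireg _ _ I0.
  apply: runs_block => //=.
  apply: (loop _ 0); rewrite ?subn0 //.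
  - by apply: Iext I0 => a ax a1 at_; rewrite /upd (negbTE ax) (negbTE at_).
  - by rewrite /upd eqxx; case: eqP => //; lia.
  - rewrite /upd eqxx /= !eqxx.
    by case: (b =P x) bx => // _ _; rewrite hb.
elim=> [|j IH] i m0 hj hi hI hx ht.
  exists (upd m0 1 0%R), 3; split=> //.
    by constructor; rewrite /= ht; lia.
  have -> : B = i by lia.
  by apply: Iext hI => a ax a1 at_; rewrite /upd (negbTE a1).
have hiB : i < B by lia.
have [m1 [k1 [e1 le1 [I1 x1]]]] := Ibody _ _ hiB hI hx.
have [hb1 ho1] := Ireg _ _ I1.
set m2 := foldl eff m1 [:: IAdd x x rOne; ISub rTest x b].
have E2 : forall a, upd m2 1 0%R a =
   if a == 1 then 0%R else if a == 2 then (Posz i.+1 - Posz B)%R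
   else if a == x then Posz i.+1 else m1 a.
  move=> a; rewrite /m2 /= /upd x1 ho1 eqxx (negbTE bx) hb1.
  have -> : (Posz i + 1)%R = Posz i.+1 by lia.
  by [].
have [|||||m3 [k3 [e3 le3 I3]]] := IH i.+1 (upd m2 1 0%R).
- by lia.
- by [].
- apply: Iext I1 => a ax a1 at_.
  by rewrite E2 (negbTE ax) (negbTE a1) (negbTE at_).
- by rewrite E2 eqxx; do 2 (case: eqP; first lia).
- by rewrite E2.
exists m3, (k1 + 2 + 3 + k3); split=> //; last by lia.
apply: (@exec_while_true _ _ _ _ m2) e3; first by rewrite /= ht; lia.
by apply: exec_seq e1 _; apply: exec_block.
Qed.

(** * Computable predicates *)

Definition polyb (g : nat -> nat) : Prop :=
  exists C k, forall n, g n <= C * n.+1 ^ k.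

Lemma polyb_const b : polyb (fun=> b).
Proof. by exists b, 0 => n; rewrite muln1. Qed.

Lemma polyb_id : polyb id.
Proof. by exists 1, 1 => n; rewrite mul1n expn1. Qed.

Lemma polyb_add f g : polyb f -> polyb g -> polyb (fun n => f n + g n).
Proof.
move=> [C [k hf]] [C' [k' hg]]; exists (C + C'), (k + k') => n.
rewrite mulnDl leq_add //.
  by apply: leq_trans (hf n) _; rewrite leq_mul2l leq_pexp2l ?leq_addr ?orbT.
by apply: leq_trans (hg n) _; rewrite leq_mul2l leq_pexp2l ?leq_addl ?orbT.
Qed.

Lemma polyb_mul f g : polyb f -> polyb g -> polyb (fun n => f n * g n).
Proof.
move=> [C [k hf]] [C' [k' hg]]; exists (C * C'), (k + k') => n.
by rewrite expnD mulnACA leq_mul.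
Qed.

Lemma polyb_shift f b : polyb f -> polyb (fun n => f (n + b)).
Proof.
move=> [C [k hf]]; exists (C * b.+1 ^ k), k => n.
apply: leq_trans (hf _) _; rewrite -mulnA -expnMn leq_mul2l; apply/orP; right.
by case: k {hf} => [|k]; rewrite ?expn0 // leq_exp2r //; nia.
Qed.

Lemma polyb_scale a : polyb (fun n => a * n).
Proof. by exists a, 1 => n; rewrite expn1 leq_mul2l leqnSn orbT. Qed.

Ltac polyb_tac := repeat first [assumption | exact: polyb_const | exact: polyb_id
  | exact: polyb_scale | apply: polyb_add | apply: polyb_mul].

(* [cT] is the part of the table filled so far; [bE], [bTau] and [bT] are the
   base addresses of the edges, the thresholds and the table. *)
Record ctx := Ctx {
  cn : nat; cN : nat; cE : nat -> nat -> bool; ctau : nat -> int;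
  cT : seq bool; bE : nat; bTau : nat; bT : nat }.

Inductive atom := An | Ak of nat | Av of nat.

Definition aval (c : ctx) (s : seq nat) (a : atom) : nat :=
  match a with An => cn c | Ak k => k | Av i => nth 0 s i end.

Definition tmval (c : ctx) (s : seq nat) (t : seq atom) : nat :=
  sumn (map (aval c s) t).

Definition wf (d : nat) (a : atom) : bool := if a is Av i then i < d else true.

(** Sums of atoms suffice for all that the formulas compare or look up, so terms compile to
    additions alone. Hiding the syntax behind an existential keeps the formulas ordinary
    functions. *)
Definition term (d : nat) (f : ctx -> seq nat -> nat) : Prop :=
  exists2 t, all (wf d) t & forall c s, size s = d -> f c s = tmval c s t.

(** Horner's rule in base [N]: for digits below [N], the order of positions is the lexicographic
    order of tuples. *)
Definition idx (N : nat) (xs : seq nat) : nat := foldl (fun a x => a * N + x) 0 xs.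

(** [R] separates the registers from the data. Edges are promised only below the diagonal, since
    registers may have overwritten row 0. The table field covers all [i]: cells not yet filled hold
    0 and read as false. *)
Record minv (R d : nat) (c : ctx) (s : seq nat) (m : memory) : Prop := Inv {
  inv_size : size s = d;
  inv_n : m 0 = Posz (cn c);
  inv_nN : cn c <= cN c;
  inv_one : m rOne = 1%R;
  inv_N : m rN = Posz (cN c);
  inv_bE : m rEdge = Posz (bE c);
  inv_bTau : m rTau = Posz (bTau c);
  inv_bT : m rTab = Posz (bT c);
  inv_var : forall i, i < d -> m (rVar i) = Posz (nth 0 s i);
  inv_R : rVar d <= R;
  inv_E : forall x y, y < x -> x < cn c ->
    R <= bE c + x * cn c + y < bT c /\ m (bE c + x * cn c + y) = Posz (cE c x y);
  inv_tau : forall x, x < cn c -> R <= bTau c + x < bT c /\ m (bTau c + x) = ctau c x;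
  inv_RT : R <= bT c;
  inv_T : forall i, m (bT c + i) = Posz (nth false (cT c) i) }.

(** Registers 1 to 3 are scratch, and those from [rVar d] to below [R] are local to code with [d]
    variables; everything else must survive. *)
Definition kept (d R a : nat) : bool := [|| a == 0, 3 < a < rVar d | R <= a].

Definition keep (d R : nat) (m m' : memory) : Prop :=
  forall a, kept d R a -> m' a = m a.

Lemma keep_trans d R m1 m2 m3 : keep d R m1 m2 -> keep d R m2 m3 -> keep d R m1 m3.
Proof. by move=> h1 h2 a ha; rewrite h2 // h1. Qed.

Lemma keepS d R m m' : keep d.+1 R m m' -> keep d R m m'.
Proof. by move=> h a ha; apply: h; move: ha; rewrite /kept /rVar; lia. Qed.

Lemma keep_upd d R m m' a v :
  keep d R m m' -> ~~ kept d R a -> keep d R m (upd m' a v).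
Proof.
move=> h na b hb; rewrite /upd; case: eqP => [E|_]; last exact: h.
by rewrite -E hb in na.
Qed.

(** The invariant says nothing about registers 9 to 11, so the table pointer and the output register
    may change. *)
Lemma inv_agree R d c s m m' : minv R d c s m ->
  (forall a, kept d R a -> ~~ (8 < a < 12) -> m' a = m a) -> minv R d c s m'.
Proof.
move=> [i1 i2 i3 i4 i5 i6 i7 i8 i9 iR iE it iRT iT] h.
have R12 : 11 < R by move: iR; rewrite /rVar; lia.
have hr a : 3 < a < 9 -> m' a = m a.
  by move=> ha; apply: h; rewrite ?/kept ?/rVar; lia.
have hh a : R <= a -> m' a = m a.
  by move=> ha; apply: h; rewrite ?/kept ?/rVar; lia.
have h0 : m' 0 = m 0 by exact: h.
split=> //; rewrite ?h0 ?hr //.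
- by move=> i hi; rewrite h ?i9 // ?/kept ?/rVar; lia.
- by move=> x y yx xn; have [h1 h2] := iE x y yx xn; rewrite hh; [|case/andP: h1].
- by move=> x xn; have [h1 h2] := it x xn; rewrite hh; [|case/andP: h1].
- by move=> i; rewrite hh // (leq_trans iRT) ?leq_addr.
Qed.

Lemma inv_keep R d c s m m' : minv R d c s m -> keep d R m m' -> minv R d c s m'.
Proof. by move=> hI h; apply: inv_agree hI _ => a ha _; exact: h. Qed.

Definition acode (dst : nat) (a : atom) : seq instr :=
  match a with
  | An => [:: IAdd dst dst 0]
  | Ak k => [:: IConst rTest (Posz k); IAdd dst dst rTest]
  | Av i => [:: IAdd dst dst (rVar i)]
  end.

Definition tcode (dst : nat) (t : seq atom) : cmd :=
  Block (IConst dst 0%R :: flatten (map (acode dst) t)).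

Lemma runs_tcode R d c s m dst t : minv R d c s m -> all (wf d) t -> rVar d <= dst ->
  runs (tcode dst t) m (2 * size t + 1) (fun m' =>
    m' dst = Posz (tmval c s t) /\
    forall a, a != dst -> a != rTest -> m' a = m a).
Proof.
move=> hI ht hd; have d12 : 11 < dst by move: hd; rewrite /rVar; lia.
apply: runs_block.
- by rewrite /=; elim: t {ht} => //= a t IH; rewrite all_cat IH andbT; case: a.
- rewrite /= size_flatten /shape -map_comp.
  suff : sumn (map (size \o acode dst) t) <= 2 * size t by lia.
  by elim: t {ht} => //= a t IH; case: a => * /=; lia.
rewrite /=; set m0 := upd m dst 0%R.
have e0 : m0 dst = Posz 0 by rewrite /m0 /upd eqxx.
have f0 : forall a, a != dst -> a != rTest -> m0 a = m a.
  by move=> a h1 h2; rewrite /m0 /upd (negbTE h1).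
suff {e0 f0} : forall k m1, m1 dst = Posz k ->
    (forall a, a != dst -> a != rTest -> m1 a = m a) ->
    let m2 := foldl eff m1 (flatten (map (acode dst) t)) in
    m2 dst = Posz (k + tmval c s t) /\
    forall a, a != dst -> a != rTest -> m2 a = m a by move/(_ 0 m0 e0 f0).
elim: t ht => [|a t IH] /= ht k m1 e1 f1; first by rewrite addn0.
case/andP: ht => ha ht; rewrite foldl_cat /tmval /= addnA; apply: IH => //.
- case: a ha => [|j|i] /= ha; rewrite /upd eqxx e1.
  + by rewrite f1 ?(inv_n hI) //; lia.
  + by rewrite /=; case: eqP; first lia.
  + rewrite f1 ?(inv_var hI) //; first by apply/eqP; move: hd; rewrite /rVar; lia.
- move=> b hb1 hb2; case: a ha => [|j|i] /= ha;
    rewrite /upd (negbTE hb1) ?(negbTE hb2) ?f1 //.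
Qed.

(** Repeated addition replaces the missing multiplication. The time is linear in the factor in [b],
    which is always [n] or [N], hence polynomial. *)
Definition Mul (dst a b cnt : nat) : cmd :=
  Seq (Block [:: IConst dst 0%R]) (For cnt b (Block [:: IAdd dst dst a])).

Lemma runs_mul dst a b cnt m A B : m a = Posz A -> m b = Posz B -> m rOne = 1%R ->
  11 < dst -> 11 < cnt -> dst != cnt ->
  [/\ a != 1, a != rTest, a != dst & a != cnt] ->
  [/\ b != 1, b != rTest, b != dst & b != cnt] ->
  runs (Mul dst a b cnt) m (6 * B + 6) (fun m' => m' dst = Posz (A * B) /\
    forall x, x != dst -> x != cnt -> x != 1 -> x != rTest -> m' x = m x).
Proof.
move=> ha hb h1 hd hc dc [a1 at_ ad ac] [b1 bt bd bc].
apply: (@runs_seq _ _ _ 1 (6 * B + 5)); last by lia.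
apply: runs_block => //=.
pose I i (m' : memory) := m' dst = Posz (A * i) /\
  forall x, x != dst -> x != cnt -> x != 1 -> x != rTest -> m' x = m x.
apply: (@runs_weaken _ _ (B * (1 + 5) + 5) _ (I B)) => //; last by lia.
apply: (@runs_for _ _ _ _ _ _ I) => //.
- move=> i m1 m2 h [h2 h3]; split; first by rewrite h //; apply/eqP; lia.
  by move=> x x1 x2 x3 x4; rewrite h // h3.
- by move=> i m1 [_ h]; rewrite !h //; apply/eqP; lia.
- move=> i m1 hi [h2 h3] hx; apply: runs_block => //=; split.
    split; first by rewrite /upd eqxx h2 h3 // ha; lia.
    by move=> x x1 x2 x3 x4; rewrite /upd (negbTE x1) h3.
  by rewrite /upd eq_sym (negbTE dc).
- by split=> [|x x1 x2 x3 x4]; rewrite /upd ?eqxx ?muln0 // (negbTE x1).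
Qed.

(** A shallow notion: closure lemmas replace a compiler for formulas. One code serves every [R] from
    [R0] on, since the actual [R] is fixed only when all subprograms and their local registers are
    known. *)
Definition computable (d : nat) (P : ctx -> seq nat -> bool) : Prop :=
  exists code K R0, polyb K /\ forall R, R0 <= R -> forall c s m, minv R d c s m ->
    runs code m (K (cN c)) (fun m' => keep d R m m' /\ m' rRes = Posz (P c s)).

Lemma computable_ext d P Q : (forall c s, size s = d -> P c s = Q c s) ->
  computable d P -> computable d Q.
Proof.
move=> h [code [K [R0 [pK H]]]]; exists code, K, R0; split=> // R hR c s m hI.
by rewrite -h ?(inv_size hI) //; apply: H.
Qed.

Ltac keep_tac := first [done |
  intros; repeat match goal with x := _ : nat |- _ => subst x end;
  unfold kept, rVar in *; lia].

Lemma computable_le d f g : term d f -> term d g ->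
  computable d (fun c s => f c s <= g c s).
Proof.
move=> [t ht ft] [u hu fu].
pose A := rVar d; pose B := (rVar d).+1.
exists (Seq (tcode A t) (Seq (tcode B u)
  (Seq (Block [:: ISub A A B; ISub A A rOne])
    (If (TN A) (Block [:: IConst rRes 1%R]) (Block [:: IConst rRes 0%R]))))).
exists (fun=> (2 * size t + 1) + ((2 * size u + 1) + (2 + 4))), (rVar d.+1).
split; first exact: polyb_const.
move=> R hR c s m hI; have iR := inv_R hI.
have RA : A < R by move: hR; keep_tac.
have RB : B < R by move: hR; keep_tac.
have A12 : 11 < A by keep_tac.
apply: runs_seq (leqnn _).
apply: runs_weaken (runs_tcode hI ht (leqnn _)) (leqnn _) _ => m1 [e1 f1].
have k1 : keep d R m m1 by move=> a ha; apply: f1; apply/eqP; move: ha; keep_tac.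
have hI1 := inv_keep hI k1.
apply: runs_seq (leqnn _).
apply: runs_weaken (runs_tcode hI1 hu (leqnSn _)) (leqnn _) _ => m2 [e2 f2].
have k2 : keep d R m m2.
  by apply: keep_trans k1 _ => a ha; apply: f2; apply/eqP; move: ha; keep_tac.
have hI2 := inv_keep hI k2.
apply: runs_seq (leqnn _); apply: runs_block => //=.
set m3 := upd _ _ _.
have k3 : keep d R m m3.
  by apply: keep_upd; [apply: keep_upd => // |]; keep_tac.
have e3 : m3 A = (Posz (f c s) - Posz (g c s) - 1)%R.
  rewrite /m3 /upd !eqxx; case: (4 =P A) => [|_]; first by keep_tac.
  by rewrite f2 ?e1 ?e2 ?ft ?fu ?(inv_size hI) ?(inv_one hI2) //; apply/eqP; keep_tac.
apply: (@runs_if _ _ _ _ 1) => //= hb; apply: runs_block => //=.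
  split; first by apply: keep_upd => //; keep_tac.
  by rewrite /upd eqxx; move: hb; rewrite e3 => hb; case: leqP => //; lia.
split; first by do 2 (apply: keep_upd; last keep_tac).
by rewrite /upd /=; move: hb; rewrite e3 => hb; case: leqP => //; lia.
Qed.

Lemma computable_not d P : computable d P -> computable d (fun c s => ~~ P c s).
Proof.
move=> [code [K [R0 [pK H]]]].
exists (Seq code (Block [:: ISub rRes rOne rRes])), (fun N => K N + 1), R0.
split; first by polyb_tac.
move=> R hR c s m hI; have iR := inv_R hI; apply: runs_seq (leqnn _).
apply: runs_weaken (H R hR _ _ _ hI) (leqnn _) _ => m1 [k1 e1].
apply: runs_block => //=; split; first by apply: keep_upd => //; keep_tac.
by rewrite /upd /= e1 (inv_one (inv_keep hI k1)); case: (P c s).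
Qed.

(** [Q] is evaluated only when [P] holds. This protects the accesses to the input: out of range, an
    edge or threshold address points to unrelated data. *)
Lemma computable_guard d P (Q : ctx -> seq nat -> bool) codeQ KQ R1 : computable d P -> polyb KQ ->
  (forall R, R1 <= R -> forall c s m, minv R d c s m -> P c s ->
    runs codeQ m (KQ (cN c)) (fun m' => keep d R m m' /\ m' rRes = Posz (Q c s))) ->
  computable d (fun c s => P c s && Q c s).
Proof.
move=> [code [K [R0 [pK H]]]] pKQ HQ.
exists (Seq code (If (TZ rRes) (Block [::]) codeQ)), (fun N => K N + (KQ N + 3)), (R0 + R1).
split; first by polyb_tac.
move=> R hR c s m hI; have iR := inv_R hI; apply: runs_seq (leqnn _).
apply: runs_weaken (H R _ _ _ _ hI) (leqnn _) _; first by lia.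
move=> m1 [k1 e1]; apply: runs_if (leqnn _) => /=; rewrite e1.
  by move=> hP; apply: runs_block => //=; rewrite e1; case: (P c s) hP.
case hP: (P c s) => // _.
apply: runs_weaken (HQ R _ _ _ _ (inv_keep hI k1) hP) (leqnn _) _; first by lia.
move=> m2 [k2 e2]; split; last by rewrite /upd /= e2.
by apply: keep_upd; [apply: keep_trans k1 k2 | keep_tac].
Qed.

Lemma computable_and d P Q : computable d P -> computable d Q ->
  computable d (fun c s => P c s && Q c s).
Proof.
move=> hP [code [K [R0 [pK H]]]].
by apply: (computable_guard (R1 := R0) hP pK) => R hR c s m hI _; apply: H.
Qed.

Lemma computable_or d P Q : computable d P -> computable d Q ->
  computable d (fun c s => P c s || Q c s).
Proof.
move=> hP hQ.
apply: (@computable_ext _ (fun c s => ~~ (~~ P c s && ~~ Q c s))).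
  by move=> c s _; case: (P c s); case: (Q c s).
by apply: computable_not; apply: computable_and; apply: computable_not.
Qed.

(** Exhaustive search without early exit. The result is collected in the flag next to the loop
    variable, which survives the body because the local registers of the body lie higher. *)
Lemma computable_ex d P :
  computable d.+1 P ->
  computable d (fun c s => has (fun v => P c (rcons s v)) (iota 0 (cN c))).
Proof.
move=> [code [K [R0 [pK H]]]].
pose x := rVar d; pose F := (rVar d).+1.
exists (Seq (Block [:: IConst F 0%R])
  (Seq (For x rN (Seq code (If (TZ rRes) (Block [::]) (Block [:: IConst F 1%R]))))
       (Block [:: IConst rTest 0%R; IAdd rRes F rTest]))).
exists (fun N => 1 + ((N * (K N + 4 + 5) + 5) + 2)), (R0 + rVar d.+1).
split; first by polyb_tac.
move=> R hR c s m hI; have iR := inv_R hI.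
have RF : F < R by move: hR; keep_tac.
apply: runs_seq (leqnn _); apply: runs_block => //=; set m0 := upd m F 0%R.
have k0 : keep d R m m0 by apply: keep_upd => //; keep_tac.
apply: runs_seq (leqnn _).
pose I i (m' : memory) := keep d R m m' /\
  m' F = Posz (has (fun v => P c (rcons s v)) (iota 0 i)).
apply: (@runs_weaken _ _ _ _ (I (cN c))) (leqnn _) _; last first.
  move=> m1 [k1 e1]; apply: runs_block => //=.
  split; first by do 2 (apply: keep_upd; last keep_tac).
  by rewrite /upd /= /F e1 addr0.
apply: (runs_for (I := I)) => //; try by keep_tac.
- move=> i m1 m2 h [k1 e1]; split.
    move=> a ha; rewrite h ?k1 //; apply/eqP; move: ha; keep_tac.
  by rewrite h // /F /x /rVar; apply/eqP; lia.
- by move=> i m1 [k1 _]; have hI1 := inv_keep hI k1; rewrite (inv_one hI1) (inv_N hI1).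
- move=> i m1 hi [k1 e1] hx.
  have hI1 : minv R d.+1 c (rcons s i) m1.
    have [h1 h2 h3 h4 h5 h6 h7 h8 h9 _ iE it iRT iT] := inv_keep hI k1.
    split=> //; first by rewrite size_rcons h1.
      move=> j; rewrite ltnS leq_eqVlt nth_rcons => /orP[/eqP->|hj].
        by rewrite h1 ltnn eqxx.
      by rewrite h1 hj h9.
    by lia.
  apply: runs_seq (leqnn _).
  apply: runs_weaken (H R _ _ _ _ hI1) (leqnn _) _; first by lia.
  move=> m2 [k2 e2].
  have k12 := keep_trans k1 (keepS k2).
  have x2 : m2 x = Posz i by rewrite k2 // /kept /x /rVar; lia.
  have F2 : m2 F = m1 F by rewrite k2 // /kept /F /rVar; lia.
  rewrite /I; have -> : has (fun v => P c (rcons s v)) (iota 0 i.+1) =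
    has (fun v => P c (rcons s v)) (iota 0 i) || P c (rcons s i).
    by rewrite -addn1 iotaD has_cat /= orbF.
  apply: (@runs_if _ _ _ _ 1) => //= hz; apply: runs_block => //=; rewrite e2 in hz.
    split=> //; split=> //; rewrite F2 e1.
    by case: (P c (rcons s i)) hz => //; rewrite orbF.
  split; last by rewrite /upd; do 2 (case: eqP; [keep_tac|]).
  split; first by do 2 (apply: keep_upd; last keep_tac).
  rewrite /upd eqxx; case: eqP => [|_]; first by keep_tac.
  by case: (P c (rcons s i)) hz => //; rewrite orbT.
- by split=> //; rewrite /m0 /upd eqxx.
Qed.

Fixpoint idxcode (d : nat) (ts : seq (seq atom)) : cmd :=
  match ts with
  | [::] => Block [::]
  | t :: ts' =>
      Seq (Seq (Mul (rVar d).+1 (rVar d) rN (rVar d).+2)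
            (Seq (tcode (rVar d) t) (Block [:: IAdd (rVar d) (rVar d) (rVar d).+1])))
          (idxcode d ts')
  end.

Lemma runs_idxcode d ts : all (all (wf d)) ts -> exists2 K, polyb K &
  forall R c s m k, rVar d.+2 <= R -> minv R d c s m -> m (rVar d) = Posz k ->
  runs (idxcode d ts) m (K (cN c)) (fun m' => keep d R m m' /\
    m' (rVar d) = Posz (foldl (fun a x => a * cN c + x) k (map (tmval c s) ts))).
Proof.
elim: ts => [|t ts IH] /=.
  move=> _; exists (fun=> 0); first exact: polyb_const.
  by move=> R c s m k hR hI hk; apply: runs_block.
case/andP=> ht /IH[K pK HK].
exists (fun N => 6 * N + 6 + (2 * size t + 1 + 1) + K N).
  by polyb_tac.
move=> R c s m k hR hI hk.
apply: runs_seq (leqnn _); apply: runs_seq (leqnn _).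
apply: runs_weaken (@runs_mul _ _ _ _ _ k (cN c) hk _ _ _ _ _ _ _) (leqnn _) _;
  rewrite ?(inv_N hI) ?(inv_one hI) //;
  try by first [keep_tac | split; apply/eqP; keep_tac].
move=> m1 [e1 f1].
have k1 : keep d R m m1.
  by move=> a ha; apply: f1; apply/eqP; move: ha hR; keep_tac.
have hI1 := inv_keep hI k1.
apply: runs_seq (leqnn _).
apply: runs_weaken (runs_tcode hI1 ht (leqnn _)) (leqnn _) _ => m2 [e2 f2].
have k2 : keep d R m m2.
  apply: keep_trans k1 _ => a ha; apply: f2; apply/eqP; move: ha hR; keep_tac.
apply: runs_block => //=; set m3 := upd _ _ _.
have k3 : keep d R m m3.
  by apply: keep_upd => //; move: hR; keep_tac.
apply: runs_weaken (HK R c s m3 (k * cN c + tmval c s t) hR (inv_keep hI k3) _) (leqnn _) _.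
  rewrite /m3 /upd eqxx e2 f2 ?e1; try by apply/eqP; keep_tac.
by move=> m4 [k4 e4]; split=> //; apply: keep_trans k3 k4.
Qed.

Definition terms (d k : nat) (F : ctx -> seq nat -> seq nat) : Prop :=
  exists2 ts, all (all (wf d)) ts & size ts = k /\
    forall c s, size s = d -> F c s = map (tmval c s) ts.

(** No range check is needed: the address never lies below the table, and beyond the filled part
    both memory and [nth] read false. *)
Lemma computable_tab d k F : terms d k F ->
  computable d (fun c s => nth false (cT c) (idx (cN c) (F c s))).
Proof.
move=> [ts ht [_ hF]]; have [K pK HK] := runs_idxcode ht.
pose A := rVar d.
exists (Seq (Block [:: IConst A 0%R]) (Seq (idxcode d ts)
  (Block [:: IAdd A A rTab; ILoad rRes A]))).
exists (fun N => 1 + (K N + 2)), (rVar d.+2); split.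
  by polyb_tac.
move=> R hR c s m hI; have iR := inv_R hI.
have nA : ~~ kept d R A by move: hR; keep_tac.
apply: runs_seq (leqnn _); apply: runs_block => //=; set m0 := upd m A 0%R.
have k0 : keep d R m m0 by apply: keep_upd.
apply: runs_seq (leqnn _).
apply: runs_weaken (HK R c s m0 0 hR (inv_keep hI k0) _) (leqnn _) _.
  by rewrite /m0 /upd eqxx.
move=> m1 [k1 e1]; have k01 := keep_trans k0 k1; have hI1 := inv_keep hI k01.
have hidx : idx (cN c) (F c s) = foldl (fun a x => a * cN c + x) 0 (map (tmval c s) ts).
  by rewrite hF ?(inv_size hI).
rewrite -hidx in e1.
apply: runs_block => //=; split.
  by apply: keep_upd; [apply: keep_upd|keep_tac].
rewrite /upd /= !eqxx e1 (inv_bT hI1).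
have -> : absz (Posz (idx (cN c) (F c s)) + Posz (bT c))%R = bT c + idx (cN c) (F c s) by lia.
case: eqP => [E|_]; last by rewrite (inv_T hI1).
by have := inv_RT hI; keep_tac.
Qed.

Lemma computable_edge d P f g : term d f -> term d g -> computable d P ->
  (forall c s, size s = d -> P c s -> g c s < f c s < cn c) ->
  computable d (fun c s => P c s && cE c (f c s) (g c s)).
Proof.
move=> [t ht ft] [u hu fu] cP hP.
pose A := rVar d; pose B := A.+1; pose D := A.+2.
apply: (@computable_guard _ _ _
  (Seq (tcode A t) (Seq (tcode B u) (Seq (Mul D A 0 D.+1)
    (Block [:: IAdd A D rEdge; IAdd A A B; ILoad rRes A]))))
  (fun N => (2 * size t + 1) + ((2 * size u + 1) + (6 * N + 6 + 3))) (rVar d.+2)) => //.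
  by polyb_tac.
move=> R hR c s m hI; have iR := inv_R hI; move/(hP _ _ (inv_size hI))/andP=> [lt1 lt2].
have nA : ~~ kept d R A by keep_tac.
apply: runs_seq (leqnn _).
apply: runs_weaken (runs_tcode hI ht (leqnn _)) (leqnn _) _ => m1 [e1 f1].
have k1 : keep d R m m1 by move=> a ha; apply: f1; apply/eqP; keep_tac.
have hI1 := inv_keep hI k1.
apply: runs_seq (leqnn _).
apply: runs_weaken (runs_tcode hI1 hu (leqnSn _)) (leqnn _) _ => m2 [e2 f2].
have k2 : keep d R m m2.
  by apply: keep_trans k1 _ => a ha; apply: f2; apply/eqP; keep_tac.
have hI2 := inv_keep hI k2.
have A2 : m2 A = Posz (f c s).
  by rewrite f2; first (by rewrite e1 ft ?(inv_size hI)); apply/eqP; keep_tac.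
apply: (runs_seq (K1 := 6 * cn c + 6) (K2 := 3)); last by have := inv_nN hI; lia.
apply: runs_weaken (@runs_mul _ _ _ _ _ (f c s) (cn c) A2 _ _ _ _ _ _ _) (leqnn _) _;
  rewrite ?(inv_n hI2) ?(inv_one hI2) //;
  try by first [keep_tac | split; apply/eqP; keep_tac].
move=> m3 [e3 f3].
have k3 : keep d R m m3.
  by apply: keep_trans k2 _ => a ha; apply: f3; apply/eqP; keep_tac.
have hI3 := inv_keep hI k3.
have B3 : m3 B = Posz (g c s).
  by rewrite f3; first (by rewrite e2 fu ?(inv_size hI)); apply/eqP; keep_tac.
apply: runs_block => //=; split.
  by apply: keep_upd; [do 2 (apply: keep_upd => //)|keep_tac].
rewrite /upd /= !eqxx e3 (inv_bE hI3).
case: (B =P A) => [|_]; first by keep_tac.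
rewrite B3; have [h1 h2] := inv_E hI3 lt1 lt2.
set a := absz _.
have -> : a = bE c + f c s * cn c + g c s by rewrite /a; lia.
case: eqP => [E|_]; last by rewrite h2.
by move: h1; rewrite E; keep_tac.
Qed.

Lemma computable_tau d P f g : term d f -> term d g -> computable d P ->
  (forall c s, size s = d -> P c s -> f c s < cn c) ->
  computable d (fun c s => P c s && (ctau c (f c s) <= Posz (g c s))%R).
Proof.
move=> [t ht ft] [u hu fu] cP hP; pose A := rVar d; pose B := A.+1.
apply: (@computable_guard _ _ _
  (Seq (tcode A t) (Seq (tcode B u)
    (Seq (Block [:: IAdd A A rTau; ILoad A A; ISub A A B; ISub A A rOne])
      (If (TN A) (Block [:: IConst rRes 1%R]) (Block [:: IConst rRes 0%R])))))
  (fun=> (2 * size t + 1) + ((2 * size u + 1) + (4 + 4))) (rVar d.+1)) => //.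
  exact: polyb_const.
move=> R hR c s m hI; have iR := inv_R hI; move/(hP _ _ (inv_size hI))=> lt1.
have nA : ~~ kept d R A by keep_tac.
apply: runs_seq (leqnn _).
apply: runs_weaken (runs_tcode hI ht (leqnn _)) (leqnn _) _ => m1 [e1 f1].
have k1 : keep d R m m1 by move=> a ha; apply: f1; apply/eqP; keep_tac.
have hI1 := inv_keep hI k1.
apply: runs_seq (leqnn _).
apply: runs_weaken (runs_tcode hI1 hu (leqnSn _)) (leqnn _) _ => m2 [e2 f2].
have k2 : keep d R m m2.
  by apply: keep_trans k1 _ => a ha; apply: f2; apply/eqP; keep_tac.
have hI2 := inv_keep hI k2.
have A2 : m2 A = Posz (f c s).
  by rewrite f2; first (by rewrite e1 ft ?(inv_size hI)); apply/eqP; keep_tac.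
have B2 : m2 B = Posz (g c s) by rewrite e2 fu ?(inv_size hI).
apply: runs_seq (leqnn _); apply: runs_block => //=.
set m3 := upd _ _ _.
have k3 : keep d R m m3 by do 4 (apply: keep_upd => //).
have e3 : m3 A = (ctau c (f c s) - Posz (g c s) - 1)%R.
  rewrite /m3 /upd !eqxx /=.
  case: (4 =P A) => [|_]; first by keep_tac.
  case: (B =P A) => [|_]; first by keep_tac.
  rewrite (inv_one hI2) A2 B2 (inv_bTau hI2).
  have [h1 h2] := inv_tau hI2 lt1.
  have -> : absz (Posz (f c s) + Posz (bTau c))%R = bTau c + f c s by lia.
  case: eqP => [E|_]; last by rewrite h2.
  by move: h1; rewrite E; keep_tac.
apply: (@runs_if _ _ _ _ 1) => //= hb; apply: runs_block => //=.
  split; first by apply: keep_upd => //; keep_tac.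
  by move: hb; rewrite /upd eqxx e3; case: lerP => // *; lia.
split; first by do 2 (apply: keep_upd; last keep_tac).
by move: hb; rewrite /upd /= e3; case: lerP => // *; lia.
Qed.

(** * Closure properties: terms, connectives, bounded quantifiers over tuples *)

Lemma tmval1 c s a : tmval c s [:: a] = aval c s a.
Proof. exact: addn0. Qed.

Lemma term_const d k : term d (fun _ _ => k).
Proof. by exists [:: Ak k] => // c s _; rewrite tmval1. Qed.

Lemma term_n d : term d (fun c _ => cn c).
Proof. by exists [:: An] => // c s _; rewrite tmval1. Qed.

Lemma term_var d i : i < d -> term d (fun _ s => nth 0 s i).
Proof. by move=> hi; exists [:: Av i] => [|c s _]; rewrite ?tmval1 //= hi. Qed.

Lemma term_add d f g : term d f -> term d g -> term d (fun c s => f c s + g c s).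
Proof.
move=> [t ht ft] [u hu gu]; exists (t ++ u); first by rewrite all_cat ht.
by move=> c s hs; rewrite /tmval map_cat sumn_cat ft // gu.
Qed.

Lemma term_ext d f g : (forall c s, size s = d -> f c s = g c s) -> term d f -> term d g.
Proof. by move=> h [t ht ft]; exists t => // c s hs; rewrite -h // ft. Qed.

Lemma term_succ d f : term d f -> term d (fun c s => (f c s).+1).
Proof.
move=> h; apply: term_ext (term_add h (term_const d 1)).
by move=> c s _; rewrite addn1.
Qed.

Lemma all_wf_leq d e t : d <= e -> all (wf d) t -> all (wf e) t.
Proof.
by move=> de; apply: sub_all => -[//|//|i] /= hi; exact: leq_trans hi de.
Qed.

Lemma tmval_take d c s t : all (wf d) t -> tmval c (take d s) t = tmval c s t.
Proof.
rewrite /tmval; elim: t => //= a t IH /andP[ha /IH->]; congr (_ + _).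
by case: a ha => //= i hi; rewrite nth_take.
Qed.

Lemma term_up d k f : term d f -> term (d + k) (fun c s => f c (take d s)).
Proof.
move=> [t ht ft]; exists t; first exact: all_wf_leq (leq_addr _ _) ht.
by move=> c s hs; rewrite ft ?tmval_take // size_take hs; case: ltngtP; lia.
Qed.

Lemma terms_nil d : terms d 0 (fun _ _ => [::]).
Proof. by exists [::]. Qed.

Lemma terms_cons d k f F : term d f -> terms d k F ->
  terms d k.+1 (fun c s => f c s :: F c s).
Proof.
move=> [t ht ft] [ts hts [sts Fts]]; exists (t :: ts); first by rewrite /= ht.
by split=> [|c s hs]; rewrite /= ?sts // ft // Fts.
Qed.

Lemma terms_cat d k k' F F' : terms d k F -> terms d k' F' ->
  terms d (k + k') (fun c s => F c s ++ F' c s).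
Proof.
move=> [ts hts [sts Fts]] [us hus [sus Fus]]; exists (ts ++ us).
  by rewrite all_cat hts.
by split=> [|c s hs]; rewrite ?size_cat ?sts ?sus // map_cat Fts // Fus.
Qed.

Lemma terms_nseq d k f : term d f -> terms d k (fun c s => nseq k (f c s)).
Proof.
by move=> h; elim: k => [|k IH]; [exact: terms_nil | exact: terms_cons].
Qed.

Lemma terms_up d k j F : terms d j F -> terms (d + k) j (fun c s => F c (take d s)).
Proof.
move=> [ts hts [sts Fts]]; exists ts.
  by apply: sub_all hts => t; apply: all_wf_leq; exact: leq_addr.
split=> // c s hs; rewrite Fts; last by rewrite size_take hs; case: ltngtP; lia.
by elim: ts hts {sts Fts} => //= t ts IH /andP[ht /IH->]; rewrite tmval_take.
Qed.

Lemma terms_new d k : terms (d + k) k (fun _ s => drop d s).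
Proof.
exists [seq [:: Av i] | i <- iota d k].
  by rewrite all_map; apply/allP => i; rewrite mem_iota /= andbT; lia.
split=> [|c s hs]; first by rewrite size_map size_iota.
rewrite -map_comp; apply: (@eq_from_nth _ 0); first by rewrite size_drop size_map size_iota; lia.
move=> i; rewrite size_drop => hi.
rewrite (nth_map 0) ?size_iota; last by lia.
by rewrite nth_iota ?nth_drop /=; [rewrite tmval1 | lia].
Qed.

Lemma term_nth d k i F : i < k -> terms d k F -> term d (fun c s => nth 0 (F c s) i).
Proof.
move=> hi [ts hts [sts Fts]]; exists (nth [::] ts i).
  by move/(all_nthP [::]): hts; apply; rewrite sts.
by move=> c s hs; rewrite Fts // (nth_map [::]) // sts.
Qed.

Lemma computable_cst d b : computable d (fun _ _ => b).
Proof.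
apply: (@computable_ext _ (fun _ _ => (~~ b : nat) <= 0)) => [c s _|]; first by case: b.
exact: computable_le (term_const _ _) (term_const _ _).
Qed.

Lemma computable_lt d f g : term d f -> term d g ->
  computable d (fun c s => f c s < g c s).
Proof. by move=> hf hg; apply: computable_le (term_succ hf) hg. Qed.

Lemma computable_eq d f g : term d f -> term d g ->
  computable d (fun c s => f c s == g c s).
Proof.
move=> hf hg; apply: (@computable_ext _ (fun c s => (f c s <= g c s) && (g c s <= f c s))).
  by move=> c s _; rewrite eqn_leq.
by apply: computable_and; apply: computable_le.
Qed.

Lemma computable_neq d f g : term d f -> term d g ->
  computable d (fun c s => f c s != g c s).
Proof. by move=> hf hg; apply/computable_not/computable_eq. Qed.

Lemma computable_has d (r : seq nat) P :
  (forall i, i \in r -> computable d (P i)) ->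
  computable d (fun c s => has (fun i => P i c s) r).
Proof.
elim: r => [|i r IH] h /=; first exact: computable_cst.
apply: computable_or; first by apply: h; rewrite mem_head.
by apply: IH => j hj; apply: h; rewrite inE hj orbT.
Qed.

Lemma computable_all d (r : seq nat) P :
  (forall i, i \in r -> computable d (P i)) ->
  computable d (fun c s => all (fun i => P i c s) r).
Proof.
elim: r => [|i r IH] h /=; first exact: computable_cst.
apply: computable_and; first by apply: h; rewrite mem_head.
by apply: IH => j hj; apply: h; rewrite inE hj orbT.
Qed.

Fixpoint exs (k N : nat) (p : seq nat -> bool) : bool :=
  if k is k'.+1 then has (fun v => exs k' N (fun M => p (v :: M))) (iota 0 N)
  else p [::].

Lemma exsP k N (p : seq nat -> bool) :
  reflect (exists M, [/\ size M = k, all (fun x => x < N) M & p M]) (exs k N p).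
Proof.
elim: k p => [|k IH] p /=.
  apply: (iffP idP) => [h|[M [/size0nil-> _ //]]]; by exists [::].
apply: (iffP hasP) => [[v]|[[|v M] [//= [sM] /andP[hv hM] hp]]].
  rewrite mem_iota => hv /IH[M [sM hM hp]]; exists (v :: M).
  by rewrite /= sM hM hp; split=> //; rewrite andbT; lia.
by exists v; [rewrite mem_iota; lia | apply/IH; exists M].
Qed.

Lemma eq_exs k N (p q : seq nat -> bool) : p =1 q -> exs k N p = exs k N q.
Proof.
elim: k p q => [|k IH] p q h /=; first exact: h.
by apply: eq_has => v; apply: IH => M; exact: h.
Qed.

(** These are [k] nested searches, and [k] does not depend on the input, so the time stays
    polynomial. The new variables form the tail of the environment, whence [take] and [drop]. *)
Lemma computable_exs d k P :
  computable (d + k) (fun c s => P c (take d s) (drop d s)) ->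
  computable d (fun c s => exs k (cN c) (P c s)).
Proof.
elim: k d P => [|k IH] d P /= h.
  rewrite addn0 in h; apply: computable_ext h => c s hs.
  by rewrite -hs take_size drop_size.
pose Q c s' M := P c (take d s') (nth 0 s' d :: M).
apply: (@computable_ext _ (fun c s => has (fun v => exs k (cN c) (Q c (rcons s v))) (iota 0 (cN c)))).
  move=> c s hs; apply: eq_has => v; apply: eq_exs => M.
  by rewrite /Q nth_rcons hs ltnn eqxx -cats1 take_cat hs ltnn subnn cats0.
apply: (@computable_ex _ (fun c s' => exs k (cN c) (Q c s'))).
apply: IH; rewrite addSnnS; apply: computable_ext h => c s hs.
rewrite /Q take_takel // nth_take //; congr (P c _ _).
by rewrite (drop_nth 0) // hs; lia.
Qed.

Lemma computable_ex1 d (P : ctx -> seq nat -> nat -> bool) :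
  computable (d + 1) (fun c s => P c (take d s) (nth 0 (drop d s) 0)) ->
  computable d (fun c s => has (P c s) (iota 0 (cN c))).
Proof.
move=> h; apply: (@computable_ext _ (fun c s => exs 1 (cN c) (fun M => P c s (nth 0 M 0)))).
  by [].
exact: computable_exs h.
Qed.

Lemma computable_all1 d (P : ctx -> seq nat -> nat -> bool) :
  computable (d + 1) (fun c s => P c (take d s) (nth 0 (drop d s) 0)) ->
  computable d (fun c s => all (P c s) (iota 0 (cN c))).
Proof.
move=> h; apply: (@computable_ext _ (fun c s => ~~ has (fun v => ~~ P c s v) (iota 0 (cN c)))).
  by move=> c s _; rewrite has_predC negbK.
apply: computable_not; apply: (computable_ex1 (P := fun c s v => ~~ P c s v)).
exact: computable_not h.
Qed.

(** * Filling the table *)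

Definition withT (c : ctx) (T : seq bool) : ctx :=
  Ctx (cn c) (cN c) (cE c) (ctau c) T (bE c) (bTau c) (bT c).

Lemma withT_id c : withT c (cT c) = c.
Proof. by case: c. Qed.

Lemma idx_rcons N s v : idx N (rcons s v) = idx N s * N + v.
Proof. by rewrite /idx -cats1 foldl_cat. Qed.

Lemma idx_lt_expn N s : all (fun x => x < N) s -> idx N s < N ^ size s.
Proof.
elim/last_ind: s => // s v IH; rewrite all_rcons idx_rcons size_rcons expnSr.
by case/andP=> hv /IH; nia.
Qed.

Lemma idx_inj N s s' : size s = size s' -> all (fun x => x < N) s ->
  all (fun x => x < N) s' -> idx N s = idx N s' -> s = s'.
Proof.
elim/last_ind: s s' => [|s v IH] s'; first by move/esym/size0nil->.
case/lastP: s' => [|s' v']; first by rewrite size_rcons.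
rewrite !size_rcons !all_rcons !idx_rcons => -[ss] /andP[hv hs] /andP[hv' hs'] E.
have Ev : v = v'.
  by move/(congr1 (fun x => x %% N)): E; rewrite !modnMDl !modn_small.
rewrite Ev (IH s') //; move: E; rewrite Ev => /addIn /eqP.
by rewrite eqn_pmul2r => [/eqP|]; last by lia.
Qed.

Lemma idx_cat N s s' : idx N (s ++ s') = idx N s * N ^ size s' + idx N s'.
Proof.
elim/last_ind: s' => [|s' v IH]; first by rewrite cats0 muln1 addn0.
by rewrite -rcons_cat !idx_rcons IH size_rcons expnSr; nia.
Qed.

(** The digits after [y] contribute less than one unit of its position. This makes all references
    between cells well-founded. *)
Lemma idx_lex N p x y s s' : y < x -> size s = size s' ->
  all (fun z => z < N) s' -> idx N (p ++ y :: s') < idx N (p ++ x :: s).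
Proof.
move=> yx ss /idx_lt_expn h'; rewrite -!cat_rcons !idx_cat !idx_rcons ss.
by nia.
Qed.

Section Fill.
Variable phi : ctx -> seq nat -> bool.

Fixpoint fill (k : nat) (c : ctx) (s : seq nat) : seq bool :=
  if k is k'.+1 then
    foldl (fun T v => fill k' (withT c T) (rcons s v)) (cT c) (iota 0 (cN c))
  else rcons (cT c) (phi c s).

(** Each cell is judged against the table cut off just before it, so any formula defines a table.
    That the cells consulted are already there is proved later, formula by formula. *)
Definition good (a : nat) (c : ctx) (T : seq bool) : Prop :=
  forall s, size s = a -> all (fun x => x < cN c) s -> idx (cN c) s < size T ->
  nth false T (idx (cN c) s) = phi (withT c (take (idx (cN c) s) T)) s.

(** The size hypothesis says that the next free cell is the first one whose tuple starts with
    [s]. *)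
Lemma fill_good a k c s : size s + k = a -> all (fun x => x < cN c) s ->
  size (cT c) = idx (cN c) s * cN c ^ k -> good a c (cT c) ->
  good a c (fill k c s) /\ size (fill k c s) = (idx (cN c) s).+1 * cN c ^ k.
Proof.
elim: k c s => [|k IH] c s hs hN hT gT.
  rewrite /= size_rcons hT !muln1; split=> //.
  move=> s' ss' hN'; rewrite size_rcons ltnS leq_eqVlt => /orP[/eqP E|lt].
    have -> : s' = s.
      by apply: (@idx_inj (cN c)) => //; [lia | rewrite E hT muln1].
    rewrite nth_rcons hT muln1 ltnn eqxx -cats1 take_cat hT muln1 ltnn subnn cats0.
    by rewrite withT_id.
  rewrite nth_rcons lt gT // -cats1 take_cat lt.
  by [].
rewrite /=.
pose T i := foldl (fun T v => fill k (withT c T) (rcons s v)) (cT c) (iota 0 i).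
suff : forall i, i <= cN c -> good a c (T i) /\
    size (T i) = idx (cN c) s * cN c ^ k.+1 + i * cN c ^ k.
  move=> /(_ _ (leqnn _))[h1 h2]; split=> //; rewrite h2 expnS; lia.
elim=> [|i IHi] hi; first by rewrite /T /= mul0n addn0.
have [gi si] := IHi (ltnW hi).
have -> : T i.+1 = fill k (withT c (T i)) (rcons s i).
  by rewrite /T -addn1 iotaD foldl_cat.
have [||||g1 s1] := IH (withT c (T i)) (rcons s i).
- by rewrite size_rcons; lia.
- by rewrite all_rcons hi.
- by rewrite /= idx_rcons si expnS; nia.
- by [].
split; first exact: g1.
by rewrite s1 /= idx_rcons expnS; nia.
Qed.

Variables (a : nat) (code : cmd) (K : nat -> nat) (R0 : nat).
Hypothesis code_ok : forall R, R0 <= R -> forall c s m, minv R a c s m ->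
  runs code m (K (cN c)) (fun m' => keep a R m m' /\ m' rRes = Posz (phi c s)).

Fixpoint fillcode (k d : nat) : cmd :=
  if k is k'.+1 then For (rVar d) rN (fillcode k' d.+1)
  else Seq code (Block [:: IStore rPtr rRes; IAdd rPtr rPtr rOne]).

Fixpoint fillcost (k N : nat) : nat :=
  if k is k'.+1 then N * (fillcost k' N + 5) + 5 else K N + 2.

Lemma polyb_fillcost k : polyb K -> polyb (fillcost k).
Proof. by move=> pK; elim: k => [|k IH] /=; polyb_tac. Qed.

Lemma runs_fill R k d c s m : R0 <= R -> rVar a <= R -> d + k = a -> minv R d c s m ->
  m rPtr = Posz (bT c + size (cT c)) ->
  runs (fillcode k d) m (fillcost k (cN c)) (fun m' =>
    minv R d (withT c (fill k c s)) s m' /\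
    m' rPtr = Posz (bT c + size (fill k c s))).
Proof.
move=> hR0 hRa; elim: k d c s m => [|k IH] d c s m hd hI hp.
  have E : d = a by lia.
  rewrite E in hI *; apply: runs_seq (leqnn _).
  apply: runs_weaken (code_ok hR0 hI) (leqnn _) _ => m1 [k1 e1].
  have hI1 := inv_keep hI k1.
  have p1 : m1 rPtr = Posz (bT c + size (cT c)).
    by rewrite k1 // /kept /rVar.
  have RT := inv_RT hI; have iR := inv_R hI.
  apply: runs_block => //=; rewrite /upd /= p1 e1 /=.
  have ne x : x < R -> (x == bT c + size (cT c)) = false.
    by move=> hx; apply/eqP; lia.
  rewrite ne; last by keep_tac.
  rewrite (inv_one hI1) ne; last by keep_tac.
  split; last by rewrite size_rcons; lia.
  case: hI1 => i1 i2 i3 i4 i5 i6 i7 i8 i9 _ iE it iRT iT.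
  split=> //=; rewrite ?ne //; try by keep_tac.
  - by move=> i hi; do ?[case: eqP => [|_]; first by keep_tac]; rewrite i9.
  - move=> x y yx xn; have [h1 h2] := iE x y yx xn; split=> //.
    by do ?[case: eqP => [|_]; first by keep_tac].
  - move=> x xn; have [h1 h2] := it x xn; split=> //.
    by do ?[case: eqP => [|_]; first by keep_tac].
  - move=> i; case: eqP => [|_]; first by keep_tac.
    rewrite eqn_add2l nth_rcons iT; case: eqP => [->|hne]; first by rewrite ltnn.
    by case: ltnP => // h; rewrite nth_default.
pose T i := foldl (fun T v => fill k (withT c T) (rcons s v)) (cT c) (iota 0 i).
pose I i m' := minv R d (withT c (T i)) s m' /\ m' rPtr = Posz (bT c + size (T i)).
have ins i m1 m2 : (forall b, b != rVar d -> b != 1 -> b != rTest -> m2 b = m1 b) ->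
    I i m1 -> I i m2.
  move=> h [h1 h2]; split.
    by apply: inv_keep h1 _ => b hb; apply: h; apply/eqP; move: hRa; keep_tac.
  by rewrite h //; apply/eqP; keep_tac.
apply: (@runs_for _ _ _ _ _ _ I) => //; try by keep_tac.
- by move=> i m1 [h1 _]; rewrite (inv_N h1) (inv_one h1).
- move=> i m1 hi [h1 h2] hx.
  have hI1 : minv R d.+1 (withT c (T i)) (rcons s i) m1.
    case: h1 => i1 i2 i3 i4 i5 i6 i7 i8 i9 _ iE it iRT iT.
    split=> //; first by rewrite size_rcons i1.
      move=> j; rewrite ltnS leq_eqVlt nth_rcons => /orP[/eqP->|hj].
        by rewrite i1 ltnn eqxx.
      by rewrite i1 hj i9.
    by move: hRa; keep_tac.
  apply: runs_weaken (IH _ _ _ _ _ hI1 h2) (leqnn _) _; first by lia.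
  move=> m2 [h3 h4].
  have ET : T i.+1 = fill k (withT c (T i)) (rcons s i).
    by rewrite /T -addn1 iotaD foldl_cat.
  rewrite /I ET; split.
    split=> //; case: h3 => i1 i2 i3 i4 i5 i6 i7 i8 i9 iR iE it iRT iT.
    split=> //; first by move: i1; rewrite size_rcons => -[].
      move=> j hj; rewrite i9; last by lia.
      by rewrite nth_rcons (inv_size hI) hj.
    by keep_tac.
  by rewrite (inv_var h3) // nth_rcons (inv_size hI) ltnn eqxx.
- by split=> //; case: hI => *; split.
Qed.

End Fill.

(** * Input, set-up and output *)

Definition natE (n : nat) (e : rel 'I_n) (x y : nat) : bool :=
  if insub x is Some i then if insub y is Some j then e i j else false else false.

Definition nattau (n : nat) (tau : 'I_n -> int) (x : nat) : int :=
  if insub x is Some i then tau i else 0%R.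

Lemma encode_edge n (e : rel 'I_n) tau x y : x < n -> y < n ->
  encode e tau (1 + x * n + y) = Posz (natE e x y).
Proof.
move=> hx hy; rewrite /encode /natE.
have -> : 1 + x * n + y == 0 = false by apply/eqP; lia.
have -> : 1 + x * n + y <= n * n by nia.
have -> : (1 + x * n + y).-1 = x * n + y by lia.
rewrite divnMDl ?modnMDl; last by lia.
rewrite divn_small ?modn_small // addn0.
by case: insubP => [i|/negP//] _ _; case: insubP => [j|/negP//].
Qed.

Lemma encode_tau n (e : rel 'I_n) tau x : x < n ->
  encode e tau (1 + n * n + x) = nattau tau x.
Proof.
move=> hx; rewrite /encode /nattau.
have -> : 1 + n * n + x == 0 = false by apply/eqP; lia.
have -> : 1 + n * n + x <= n * n = false by lia.
have -> : 1 + n * n + x <= n * n + n by lia.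
by have -> : (1 + n * n + x).-1 - n * n = x by lia.
Qed.

Lemma encode_out n (e : rel 'I_n) tau x : n * n + n < x -> encode e tau x = 0%R.
Proof.
move=> hx; rewrite /encode.
have -> : x == 0 = false by apply/eqP; lia.
have -> : x <= n * n = false by lia.
by have -> : x <= n * n + n = false by lia.
Qed.

Lemma encode1 n (e : rel 'I_n) tau : irreflexive e -> 0 < n -> encode e tau 1 = 0%R.
Proof.
move=> he hn; have := encode_edge e tau hn hn; rewrite addn0 mul0n addn0 => ->.
by rewrite /natE; case: insubP => // i _ _; rewrite he.
Qed.

Record laid (R : nat) (n : nat) (e : rel 'I_n) (tau : 'I_n -> int) (b : nat)
    (m : memory) : Prop := Laid {
  laid_n : m 0 = Posz n;
  laid_b : m rEdge = Posz b;
  laid_E : forall x y, y < x -> x < n ->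
    R <= b + x * n + y /\ m (b + x * n + y) = Posz (natE e x y);
  laid_tau : forall x, x < n ->
    R <= b + n * n + x /\ m (b + n * n + x) = nattau tau x;
  laid_R : R <= b + n * n + n;
  laid_0 : forall i, m (b + n * n + n + i) = 0%R }.

(* The input occupies every low address. If [n >= R], the registers overlap only
   row 0 of the adjacency matrix, which is never read since an edge is looked up
   in the row of its larger end. If [n < R], the whole input is copied away by
   straight-line code; register 1 initially holds the entry (0,0), that is 0. *)
Definition copy (B k : nat) : seq instr :=
  [seq IAdd (B + a) a 1 | a <- iota 1 (k * k + k)].

Fixpoint dispatch (B k : nat) : cmd :=
  if k is k'.+1 then
    Seq (Block [:: IConst 1 (Posz k'); ISub 1 0 1])
      (If (TZ 1)
        (Block (IConst 1 0%R :: copy B k' ++ [:: IConst rEdge (Posz B.+1)]))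
        (dispatch B k'))
  else Block [:: IConst rEdge 1%R].

Fixpoint dispatch_cost (k : nat) : nat :=
  if k is k'.+1 then 2 + ((k' * k' + k' + 2 + dispatch_cost k') + 3) else 1.

Lemma foldl_copy B k (m : memory) : k * k + k <= B -> m 1 = 0%R ->
  forall x, foldl eff m (copy B k) x =
    if B < x <= B + (k * k + k) then m (x - B) else m x.
Proof.
move=> + h1; rewrite /copy.
elim: (k * k + k) => [|j IH] hj x; first by rewrite /= ifF //; lia.
have -> : iota 1 j.+1 = iota 1 j ++ [:: 1 + j] by rewrite -[j.+1]addn1 iotaD.
rewrite map_cat foldl_cat /= /upd !IH; try lia.
have -> : (B < 1 + j <= B + j) = false by lia.
have -> : (B < 1 <= B + j) = false by lia.
rewrite h1 addr0; case: (x =P B + (1 + j)) => [->|hx].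
  by rewrite ifT; [congr m; lia | lia].
by have -> : (B < x <= B + j.+1) = (B < x <= B + j) by lia.
Qed.

(** The disjunction says that [n] is among the sizes still to be tested or too large to be tested at
    all, so falling through all tests leaves [R <= n]. The bound on [B] keeps copies clear of
    originals. *)
Lemma runs_dispatch n (e : rel 'I_n) tau R B m :
  irreflexive e -> 6 < R -> R * R + R <= B ->
  (forall a, a != 1 -> m a = encode e tau a) -> forall k, (n < k \/ R <= n) -> k <= R ->
  runs (dispatch B k) m (dispatch_cost k) (fun m' => exists b, laid R e tau b m').
Proof.
move=> he R6 hB hm k; elim: k m hm => [|k IH] m hm hn hk.
  have {}hn : R <= n by lia.
  apply: runs_block => //=; exists 1.
  have E x : 7 <= x -> upd m 6 1%R x = encode e tau x.
    by move=> hx; rewrite /upd; case: eqP => [|_]; [lia | rewrite hm //; apply/eqP; lia].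
  split=> //.
  - by rewrite /upd /= hm.
  - by move=> x y yx xn; rewrite E ?encode_edge //; try split=> //; nia.
  - by move=> x xn; rewrite E ?encode_tau //; try split=> //; nia.
  - by nia.
  - by move=> i; rewrite E ?encode_out //; nia.
apply: runs_seq (leqnn _); apply: runs_block => //=.
set m1 := upd _ _ _.
have E1 : m1 1 = (Posz n - Posz k)%R by rewrite /m1 /upd /= hm.
have m1E a : a != 1 -> m1 a = encode e tau a.
  by move=> ha; rewrite /m1 /upd (negbTE ha) hm.
apply: runs_if (leqnn _) => /=; rewrite E1.
  move=> hz; have Ek : k = n by lia.
  rewrite Ek in hk *; clear hz hn IH E1.
  apply: runs_block.
  - rewrite /= all_cat /= andbT /copy.
    by elim: (iota _ _).
  - by rewrite /= size_cat size_map size_iota /=; lia.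
  rewrite /= foldl_cat /=; exists B.+1.
  set m2 := upd m1 1 0%R; set m3 := foldl _ _ _.
  have E3 := @foldl_copy B n m2; rewrite -/m3 in E3.
  have {}E3 x : m3 x = if B < x <= B + (n * n + n) then m2 (x - B) else m2 x.
    by apply: E3 => //; nia.
  have m2E a : a != 1 -> m2 a = encode e tau a.
    by move=> ha; rewrite /m2 /upd (negbTE ha) m1E.
  (* Register 1 has been reset to 0, which is also the diagonal entry that the input stores
     there. *)
  have m2E' a : 0 < n -> m2 a = encode e tau a.
    by move=> n0; case: (a =P 1) => [->|/eqP/m2E//]; rewrite encode1.
  have E x : B < x -> upd m3 6 (Posz B.+1) x =
      if x <= B + (n * n + n) then m2 (x - B) else m2 x.
    by move=> hx; rewrite /upd; case: eqP => [|_]; [nia | rewrite E3 hx].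
  split=> //.
  - by rewrite /upd /= E3 m2E.
  - move=> x y yx xn; rewrite E; last by nia.
    rewrite ifT; last by nia.
    rewrite m2E' //; last by lia.
    split; first by nia.
    by rewrite -(encode_edge e tau) //; [congr encode; nia | lia].
  - move=> x xn; rewrite E; last by nia.
    rewrite ifT; last by nia.
    rewrite m2E' //; last by lia.
    split; first by nia.
    by rewrite -(encode_tau e) //; congr encode; nia.
  - by nia.
  - move=> i; rewrite E; last by nia.
    rewrite ifF; last by apply/negP; nia.
    by rewrite m2E ?encode_out //; nia.
move=> hz; apply: runs_weaken (IH m1 m1E _ _) (leq_addl _ _) _; try lia.
move=> m2 [b [l1 l2 l3 l4 l5 l6]]; exists b.
have E x : x != 1 -> upd m2 1 0%R x = m2 x by move=> hx; rewrite /upd (negbTE hx).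
split=> //.
- by move=> x y yx xn; have [h1 h2] := l3 x y yx xn; rewrite E //; apply/eqP; lia.
- by move=> x xn; have [h1 h2] := l4 x xn; rewrite E //; apply/eqP; lia.
- by move=> i; rewrite E //; apply/eqP; lia.
Qed.

Definition setup (b : nat) : cmd :=
  Seq (Block [:: IConst rOne 1%R; IConst rN (Posz b); IAdd rN rN 0])
    (Seq (Mul 12 0 0 13)
      (Block [:: IAdd rTau rEdge 12; IAdd rTab rTau 0; IConst rTest 0%R;
        IAdd rPtr rTab rTest])).

Definition ctx0 n (e : rel 'I_n) (tau : 'I_n -> int) (b B : nat) : ctx :=
  Ctx n (n + b) (natE e) (nattau tau) [::] B (B + n * n) (B + n * n + n).

Lemma runs_setup n (e : rel 'I_n) tau R b B m : 14 <= R -> laid R e tau B m ->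
  runs (setup b) m (3 + ((6 * n + 6) + 4)) (fun m' =>
    minv R 0 (ctx0 e tau b B) [::] m' /\ m' rPtr = Posz (B + n * n + n)).
Proof.
move=> hR [l1 l2 l3 l4 l5 l6].
apply: runs_seq (leqnn _); apply: runs_block => //=; set m1 := upd _ _ _.
have n1 : m1 0 = Posz n by [].
apply: runs_seq (leqnn _).
apply: runs_weaken (@runs_mul 12 0 0 13 m1 n n n1 n1 _ _ _ _ _ _) (leqnn _) _ => //.
move=> m2 [e2 f2]; apply: runs_block => //=; set m3 := upd _ _ _.
have N1 : m1 rN = Posz (n + b) by rewrite /m1 /upd /= l1; lia.
have E x : 14 <= x -> m3 x = m x.
  move=> hx; rewrite /m3 /upd; do !case: eqP => [|_]; try lia.
  rewrite f2; try by apply/eqP; lia.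
  by rewrite /m1 /upd; do !case: eqP => [|_]; try lia.
split; last first.
  by rewrite /m3 /upd /= e2 !f2 // n1 /m1 /upd /= l2; lia.
split=> //=.
- by rewrite /m3 /upd /= f2.
- by lia.
- by rewrite /m3 /upd /= f2.
- by rewrite /m3 /upd /= f2.
- by rewrite /m3 /upd /= f2 // /m1 /upd /= l2.
- by rewrite /m3 /upd /= e2 f2 // /m1 /upd /= l2; lia.
- by rewrite /m3 /upd /= e2 !f2 // n1 /m1 /upd /= l2; lia.
- by rewrite /rVar; lia.
- move=> x y yx xn; have [h1 h2] := l3 x y yx xn; split; first by nia.
  by rewrite E //; lia.
- move=> x xn; have [h1 h2] := l4 x xn; split; first by nia.
  by rewrite E //; lia.
- by move=> i; rewrite E ?l6 ?nth_nil //; lia.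
Qed.

Definition outcode (code : cmd) : cmd :=
  Seq (For (rVar 0) rN (Seq code (If (TZ rRes) (Block [::])
          (Block [:: IConst rTest 0%R; IAdd rOut (rVar 0) rTest]))))
    (Block [:: IConst rTest 0%R; IAdd 0 rOut rTest]).

(** The loop does not stop at [v]; as the only hit, [v] is what remains in [rOut]. *)
Lemma runs_out (P : ctx -> seq nat -> bool) code K R0 R c m v : R0 <= R -> rVar 1 <= R ->
  (forall R, R0 <= R -> forall c s m, minv R 1 c s m ->
    runs code m (K (cN c)) (fun m' => keep 1 R m m' /\ m' rRes = Posz (P c s))) ->
  minv R 0 c [::] m -> v < cN c -> (forall u, u < cN c -> P c [:: u] = (u == v)) ->
  runs (outcode code) m (cN c * ((K (cN c) + (2 + 3)) + 5) + 5 + 2) (fun m' => m' 0 = Posz v).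
Proof.
move=> hR0 hR1 H hI hv hP.
apply: runs_seq (leqnn _).
pose I i m' := minv R 0 c [::] m' /\ (v < i -> m' rOut = Posz v).
apply: (@runs_weaken _ _ _ _ (I (cN c))) (leqnn _) _; last first.
  by move=> m1 [h1 h2]; apply: runs_block => //=; rewrite /upd /= h2 // addr0.
apply: (@runs_for _ _ _ _ _ _ I) => //.
- move=> i m1 m2 h [h1 h2]; split.
    by apply: inv_keep h1 _ => b hb; apply: h; apply/eqP; keep_tac.
  by move=> hvi; rewrite h ?h2.
- by move=> i m1 [h1 _]; rewrite (inv_N h1) (inv_one h1).
- move=> i m1 hi [h1 h2] hx.
  have hI1 : minv R 1 c [:: i] m1.
    case: h1 => i1 i2 i3 i4 i5 i6 i7 i8 i9 _ iE it iRT iT.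
    by split=> //; case.
  apply: runs_seq (leqnn _).
  apply: runs_weaken (H R hR0 _ _ _ hI1) (leqnn _) _ => m2 [k2 e2].
  have hI2 := inv_keep h1 (keepS k2).
  have o2 : m2 rOut = m1 rOut by rewrite k2.
  have x2 : m2 (rVar 0) = Posz i by rewrite k2.
  rewrite hP // in e2.
  apply: runs_if (leqnn _) => /=; rewrite e2 => hz; apply: runs_block => //=.
    split=> //; split=> // hvi; rewrite o2 h2 //.
    by case: (i =P v) hz hvi => //; lia.
  have {hz} E : i = v by case: (i =P v) hz.
  split=> //; split.
    apply: inv_agree hI2 _ => b hb hb'; rewrite /upd.
    by do !case: eqP => [|_] //; move: hb hb'; keep_tac.
  by move=> _; rewrite /upd /= x2 E addr0.
Qed.

(** This reduces the theorem to combinatorics: formulas are wanted whose table determines the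
    answer. The base addresses in [c] stay arbitrary because they depend on whether the input was
    copied. *)
Theorem table_machine (a b : nat) phi out : computable a phi -> computable 1 out ->
  exists p C k, forall n (e : rel 'I_n) (tau : 'I_n -> int) v, irreflexive e ->
    (forall c, cn c = n -> cN c = n + b -> cE c = natE e -> ctau c = nattau tau ->
      good phi a c (cT c) -> size (cT c) = (n + b) ^ a ->
      v < n + b /\ forall u, u < n + b -> out c [:: u] = (u == v)) ->
    run p (C * n.+1 ^ k) 0 (encode e tau) = Some (Posz v).
Proof.
move=> [code [K [R0 [pK H]]]] [code' [K' [R0' [pK' H']]]].
pose R := 14 + R0 + R0' + rVar a + rVar 1; pose B := R * R + R.
pose prog := Seq (dispatch B R) (Seq (setup b)
  (Seq (fillcode code a 0) (outcode code'))).
pose cost n := dispatch_cost R + ((3 + ((6 * n + 6) + 4)) + (fillcost K a (n + b) +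
  ((n + b) * (K' (n + b) + (2 + 3) + 5) + 5 + 2))).
have [C [k hCk]] : polyb cost.
  rewrite /cost; polyb_tac.
    by apply: (polyb_shift (f := fillcost K a)); apply: polyb_fillcost.
  exact: (polyb_shift (f := K')).
exists (compile 0 prog), C, k => n e tau v he hv.
suff [m' [j [hex hle hm']]] : runs prog (encode e tau) (cost n) (fun m' => m' 0 = Posz v).
  by rewrite (exec_run_whole hex) ?hm' // (leq_trans hle).
rewrite /prog /cost.
have hR : [/\ R0 <= R, R0' <= R, rVar a <= R, rVar 1 <= R & 14 <= R] by rewrite /R; split; lia.
case: hR => hR0 hR0' hRa hR1 hR14.
apply: runs_seq (leqnn _).
apply: (@runs_weaken _ _ _ _ _ _ (runs_dispatch (e := e) (tau := tau) (R := R) he _ _ _ _ _)) => //; try lia.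
move=> m1 [BE l1]; apply: runs_seq (leqnn _).
apply: runs_weaken (runs_setup b hR14 l1) (leqnn _) _ => m2 [I2 p2].
apply: runs_seq (leqnn _).
set c0 := ctx0 e tau b BE in I2.
have p2' : m2 rPtr = Posz (bT c0 + size (cT c0)) by rewrite p2 /= addn0.
apply: runs_weaken (runs_fill H hR0 hRa (add0n _) I2 p2') (leqnn _) _ => m3 [I3 _].
set c := withT _ _ in I3.
have [g3 s3] : good phi a c0 (fill phi a c0 [::]) /\
    size (fill phi a c0 [::]) = (idx (cN c0) [::]).+1 * cN c0 ^ a by exact: fill_good.
have sc : size (cT c) = (n + b) ^ a by rewrite /= s3 mul1n.
have [hvN hout] := hv c (erefl _) (erefl _) (erefl _) (erefl _) g3 sc.
exact: (runs_out hR0' hR1 H' I3 hvN hout).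
Qed.

(** * The elimination forest *)

Section Forest.
Variables (n : nat) (E : rel nat).

Definition inK (y x : nat) : bool := (y < x) && E y x.
Definition inB (v x : nat) : bool := (v < n) && (x == v) || inK v x.
(** [find] yields [n] when there is no later neighbour, so [n] is a virtual root that turns the
    forest into a tree. *)
Definition par (y : nat) : nat := find (inK y) (iota 0 n).
Definition desc (u y : nat) : bool := has (fun k => iter k par u == y) (iota 0 n.+1).
(** The region handled so far at [v]: the subtrees of its children below [j]. Children precede their
    parent, so [W v v] is everything strictly below [v] in the tree. *)
Definition W (v j u : nat) : bool :=
  (u < n) && has (fun y => (par y == v) && desc u y) (iota 0 j).
Definition cnt (P : pred nat) : nat := count P (iota 0 n).

Lemma cnt_or_disj (P Q : pred nat) : (forall x, x < n -> ~~ (P x && Q x)) ->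
  cnt (fun x => P x || Q x) = cnt P + cnt Q.
Proof.
move=> h; rewrite -count_predUI; set z := count (predI P Q) _.
suff -> : z = 0 by rewrite addn0.
apply/eqP; rewrite -leqn0 leqNgt -has_count; apply/hasPn => x.
by rewrite mem_iota /= => hx; apply: h; lia.
Qed.

Lemma eq_cnt (P Q : pred nat) : (forall x, x < n -> P x = Q x) -> cnt P = cnt Q.
Proof. by move=> h; apply: eq_in_count => x; rewrite mem_iota => hx; apply: h; lia. Qed.

Lemma leq_cnt (P Q : pred nat) : (forall x, x < n -> P x -> Q x) -> cnt P <= cnt Q.
Proof.
move=> h; rewrite /cnt -!size_filter; apply: uniq_leq_size.
  by rewrite filter_uniq // iota_uniq.
by move=> x; rewrite !mem_filter mem_iota => /andP[hP hx]; rewrite hx h //; lia.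
Qed.

Lemma leq_cnt_or (P Q : pred nat) : cnt (fun x => P x || Q x) <= cnt P + cnt Q.
Proof. by rewrite -count_predUI leq_addr. Qed.

Lemma cnt_pred1 y : y < n -> cnt (pred1 y) = 1.
Proof. by move=> hy; rewrite /cnt count_uniq_mem ?iota_uniq // mem_iota /= hy. Qed.

Lemma size_leq_cnt s (P : pred nat) : uniq s -> (forall x, x \in s -> x < n /\ P x) -> size s <= cnt P.
Proof.
move=> us h; rewrite /cnt -size_filter; apply: uniq_leq_size => // x /h[hx hP].
by rewrite mem_filter mem_iota hP.
Qed.

Hypothesis Ebnd : forall x y, E x y -> y < n.

Lemma par_leq y : par y <= n.
Proof. by rewrite -[X in _ <= X](size_iota 0) find_size. Qed.

Lemma inK_par y : par y < n -> inK y (par y).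
Proof.
move=> h; have hh : has (inK y) (iota 0 n) by rewrite has_find size_iota.
by have := nth_find 0 hh; rewrite nth_iota.
Qed.

Lemma par_min y x : inK y x -> par y <= x.
Proof.
move=> h; rewrite leqNgt; apply/negP => lt.
have := before_find 0 lt; rewrite nth_iota ?add0n ?h //.
by case/andP: h => _ /Ebnd.
Qed.

Lemma par_gt y : y < n -> y < par y.
Proof.
move=> hy; have := par_leq y; rewrite leq_eqVlt => /orP[/eqP->//|/inK_par].
by case/andP.
Qed.

Lemma par_n : par n = n.
Proof.
have := par_leq n; rewrite leq_eqVlt => /orP[/eqP//|lt].
by have /andP[] := inK_par lt; lia.
Qed.

Lemma iter_par_n k : iter k par n = n.
Proof. by elim: k => //= k ->; exact: par_n. Qed.

Lemma iter_par_bound k u : u <= n -> u <= iter k par u <= n /\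
  (n <= u + k -> iter k par u = n).
Proof.
elim: k u => [|k IH] u hu; first by rewrite /= leqnn hu; split=> //; lia.
rewrite iterSr; move: hu; rewrite leq_eqVlt => /orP[/eqP->|hu].
  by rewrite par_n iter_par_n leqnn.
have [h1 h2] := IH _ (par_leq u); have := par_gt hu; split; first by lia.
by move=> hk; apply: h2; lia.
Qed.

Lemma descP u y : u <= n -> reflect (exists k, iter k par u = y) (desc u y).
Proof.
move=> hu; apply: (iffP hasP) => [[k _ /eqP<-]|[k <-]]; first by exists k.
case: (leqP k n) => hk; first by exists k; rewrite ?mem_iota.
exists n; first by rewrite mem_iota; lia.
have [_ ->] := iter_par_bound n hu; last by lia.
by have [_ ->] := iter_par_bound k hu; last lia.
Qed.

Lemma desc_refl u : desc u u.
Proof. by rewrite /desc /= eqxx. Qed.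

Lemma desc_leq u y : u <= n -> desc u y -> u <= y.
Proof. by move=> hu /(descP _ hu)[k <-]; have [/andP[]] := iter_par_bound k hu. Qed.

Lemma desc_step u y : u <= n -> desc u y = (u == y) || desc (par u) y.
Proof.
move=> hu; apply/idP/orP => [/(descP _ hu)[[|k]]|[/eqP->|]].
- by move=> /= ->; left.
- by rewrite iterSr => h; right; apply/descP; [exact: par_leq | exists k].
- exact: desc_refl.
- case/(descP _ (par_leq _)) => k hk; apply/descP => //.
  by exists k.+1; rewrite iterSr.
Qed.

Lemma par_ind (P : nat -> Prop) :
  P n -> (forall u, u < n -> P (par u) -> P u) -> forall u, u <= n -> P u.
Proof.
move=> hn hs u hu; have [k] := ubnP (n - u); elim: k u hu => // k IH u hu hk.
move: hu; rewrite leq_eqVlt => /orP[/eqP->//|hu].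
by apply: hs => //; apply: IH; [exact: par_leq | have := par_gt hu; lia].
Qed.

Lemma W_ltj v j u : W v j u -> u < j.
Proof.
case/andP=> hu /hasP[y]; rewrite mem_iota => hy /andP[_].
by move/desc_leq; lia.
Qed.

Lemma W0 v u : W v 0 u = false.
Proof. by rewrite /W andbF. Qed.

(** The chain from [u] enters [y] through a child, and every child of [y] is smaller than [y]. *)
Lemma desc_W u y : u < n -> desc u y -> y < n -> (u == y) || W y y u.
Proof.
move=> hu; rewrite /W hu /=; move/ltnW: hu; move: u.
apply: par_ind => [|u hu IH]; first by move=> /desc_leq; lia.
rewrite desc_step ?(ltnW hu) // => /orP[->//|h] hy; apply/orP; right.
have [/eqP E1|/hasP[z hz /andP[h1 h2]]] := orP (IH h hy).
  apply/hasP; exists u; last by rewrite E1 eqxx desc_refl.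
  by rewrite mem_iota -E1; have := par_gt hu; lia.
by apply/hasP; exists z => //; rewrite h1 desc_step ?h2 ?orbT // ltnW.
Qed.

Lemma WS_skip v y u : par y != v -> W v y.+1 u = W v y u.
Proof.
move=> h; rewrite /W -[y.+1]addn1 iotaD has_cat /= add0n (negbTE h) !orbF //.
Qed.

Lemma WS_join v y u : y < n -> par y = v ->
  W v y.+1 u = [|| W v y u, W y y u | u == y].
Proof.
move=> hy h.
have -> : W v y.+1 u = W v y u || (u < n) && desc u y.
  by rewrite /W -[y.+1]addn1 iotaD has_cat /= add0n h eqxx orbF andb_orr.
congr (_ || _); case: (ltnP u n) => hu /=; last first.
  by rewrite /W ltnNge hu /=; case: eqP => //; lia.
apply/idP/orP => [/(desc_W hu)/(_ hy)/orP[->|->]|[|/eqP->]]; auto; last exact: desc_refl.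
move=> /andP[_ /hasP[z hz /andP[/eqP h1 h2]]].
apply/descP; first by lia.
case/descP: h2; first by lia.
by move=> k hk; exists k.+1; rewrite iterS hk h1.
Qed.

(** The ancestors of [u] form one increasing chain. If it met two children of [v], the second would
    be at or above the parent of the first, that is [v], although children are smaller than their
    parent. *)
Lemma W_disj v y u : y < n -> par y = v -> W v y u -> ~~ W y y u /\ u != y.
Proof.
move=> hy hv hW; have ltu := W_ltj hW.
split; last by apply/eqP; lia.
apply/negP => /andP[hu /hasP[z hz /andP[/eqP hz1 hz2]]].
have {z hz hz1 hz2} hdy : desc u y.
  apply/descP; first by lia.
  case/descP: hz2; first by lia.
  by move=> k hk; exists k.+1; rewrite iterS hk hz1.
case/andP: hW => _ /hasP[z]; rewrite mem_iota => hzy /andP[/eqP hz].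
clear ltu; move/ltnW: hu hdy; move: u.
apply: par_ind => [|u hu IH]; first by move=> /desc_leq; lia.
rewrite (desc_step y (ltnW hu)) (desc_step z (ltnW hu)).
case/orP=> [/eqP->|h1]; last case/orP=> [/eqP E1|]; last exact: IH.
  case/orP=> [/eqP|/desc_leq]; first by lia.
  by rewrite hv -hz; have := par_leq y; have := @par_gt z; rewrite hz; lia.
have := desc_leq (par_leq u) h1; rewrite E1 hz -hv.
by have := par_gt hy; lia.
Qed.

Hypothesis Esym : symmetric E.
Hypothesis peo : forall v x y, v < x -> v < y -> E v x -> E v y -> x != y -> E x y.

(** The running intersection property of the bags: the later neighbours of [y] form a clique whose
    first member is the parent, so the others are later neighbours of the parent. *)
Lemma inK_sub y x : inK y x -> inB (par y) x.
Proof.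
move=> hx; have le := par_min hx; have lt : par y < n.
  by apply: leq_ltn_trans le _; case/andP: hx => _ /Ebnd.
rewrite /inB lt /=; case: eqP => //= ne.
have /andP[h1 h2] := inK_par lt; case/andP: hx => h3 h4.
by rewrite /inK (@peo y) // ?andbT; [lia | apply/eqP; lia].
Qed.

(** The neighbour [m] is carried up the chain from [u] to [j]: as it lies beyond each ancestor met,
    [inK_sub] keeps it adjacent. *)
Lemma desc_nbr u j m : u < n -> desc u j -> j < m -> E u m -> E j m.
Proof.
move/ltnW; move: u.
apply: par_ind => [|u hu IH]; first by rewrite Esym => _ _ /Ebnd; lia.
rewrite desc_step ?(ltnW hu) // => /orP[/eqP->//|h] hj hE.
have hK : inK u m by rewrite /inK hE andbT; have := desc_leq (par_leq u) h; have := par_gt hu; lia.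
apply: IH => //; case/orP: (inK_sub hK) => [/andP[_ /eqP]|/andP[]//].
by have := desc_leq (par_leq u) h; lia.
Qed.

(** The bag of [v] separates the subtrees below it from all later vertices. *)
Lemma W_nbr v j u m : W v j u -> j <= v -> v < m -> E u m -> inK v m.
Proof.
case/andP=> hu /hasP[y]; rewrite mem_iota => hy /andP[/eqP h1 h2] hj hm hE.
have hE' : E y m by apply: desc_nbr hE => //; lia.
have : inB v m by rewrite -h1; apply: inK_sub; rewrite /inK hE' andbT; lia.
by case/orP=> [/andP[_ /eqP]|//]; lia.
Qed.

(** Every edge joins a vertex to one of its ancestors: climbing from [w], the bags contain [j] until
    [j] is reached. *)
Lemma lower_nbr w j : w < j -> E w j -> W j j w.
Proof.
move=> hw hE; have hj := Ebnd hE.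
have : desc w j -> W j j w.
  move=> h; have := desc_W (ltn_trans hw hj) h hj.
  by case/orP=> // /eqP; lia.
apply; have hwn := ltnW (ltn_trans hw hj); move: hwn hw hE; move: w.
apply: par_ind => [|w hw IH] lt hE; first by lia.
rewrite desc_step ?(ltnW hw) //; apply/orP; right.
have hK : inK w j by rewrite /inK lt.
case: (par w =P j) => [->|ne]; first exact: desc_refl.
by case/orP: (inK_sub hK) => [/andP[_ /eqP]|/andP[]]; [lia | exact: IH].
Qed.

Lemma W_all u : u < n -> W n n u.
Proof.
move=> hu; rewrite /W hu /=; have hu' := ltnW hu; move: hu' hu; move: u.
apply: par_ind => [|u hu IH _]; first by lia.
have := par_leq u; rewrite leq_eqVlt => /orP[/eqP h|h].
  by apply/hasP; exists u; rewrite ?mem_iota // h eqxx desc_refl.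
have /hasP[y hy /andP[h1 h2]] := IH h.
by apply/hasP; exists y => //; rewrite h1 desc_step ?h2 ?orbT // ltnW.
Qed.

End Forest.

(** * The dynamic program *)

Section Step.
Variables (t n N : nat) (E : rel nat) (tle : nat -> nat -> bool).

(* [M] has [t + 1] slots for the first vertices, in order of time, of the bag of
   [v]; an entry [>= n] is a blank slot. [r] holds a count for each slot. *)
Definition validb (v : nat) (M : seq nat) : bool :=
  all (fun p => (nth 0 M p < n) ==>
    inB n E v (nth 0 M p) &&
    all (fun q => (nth 0 M q < n) && (nth 0 M q != nth 0 M p)) (iota 0 p))
  (iota 0 t.+1).

(* Either [y] sits in slot [i], behind [i] neighbours in its bag and [r_i] below
   it, or all [t + 1 > tau y] slots are taken by other vertices of the bag. *)
Definition doneb (y : nat) (M r : seq nat) : bool :=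
  has (fun i => (nth 0 M i == y) &&
    has (fun b => (b <= i + nth 0 r i) && tle y b) (iota 0 N)) (iota 0 t.+1)
  || all (fun i => (nth 0 M i < n) && (nth 0 M i != y)) (iota 0 t.+1).

(* What the subtree of the child [y], with slots [M'] and counts [r'], adds to the
   count of slot [p]: the vertices before slot [q] of [M'], except [y], must
   precede slot [p] of [M] too; [y] itself counts when it is one of them. *)
Definition contribb (y : nat) (M r r1 M' r' : seq nat) (p : nat) : bool :=
  (nth 0 r p <= nth 0 r1 p) ||
  has (fun q => [&& nth 0 M' q == nth 0 M p, nth 0 M p < n,
    all (fun q' => (nth 0 M' q' == y) ||
      has (fun p' => nth 0 M p' == nth 0 M' q') (iota 0 p)) (iota 0 q) &
    (nth 0 r p <= nth 0 r1 p + nth 0 r' q) ||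
    (nth 0 r p <= (nth 0 r1 p + nth 0 r' q).+1) &&
    has (fun q' => nth 0 M' q' == y) (iota 0 q)]) (iota 0 t.+1).

(* [G v j M r c] stands for: cost [c] suffices for the subtrees of the children
   [y < j] of [v]. The root bag is that of [v = n], which is empty. *)
Definition joinb (G : nat -> nat -> seq nat -> seq nat -> nat -> bool)
    (v y : nat) (M r : seq nat) (c : nat) : bool :=
  exs t.+1 N (fun r1 => exs t.+1 N (fun M' => exs t.+1 N (fun r' =>
    has (fun c1 => has (fun c' =>
      [&& G v y M r1 c1, G y y M' r' c',
          ((c1 + c').+1 <= c) || (c1 + c' <= c) && doneb y M' r' &
          all (contribb y M r r1 M' r') (iota 0 t.+1)]) (iota 0 N)) (iota 0 N)))).

(* [par y == v], in bounded-quantifier form. *)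
Definition parb (y v : nat) : bool :=
  (v < n) && inK E y v && all (fun w => (w < v) ==> ~~ inK E y w) (iota 0 N)
  || (v == n) && all (fun w => ~~ inK E y w) (iota 0 N).

(** For [j = y.+1] only cells with prefix [(v, y)] and, when [y] is a child of [v], [(y, y)] are
    consulted, all of them earlier. Attaching one child at a time keeps the number of guessed tuples
    fixed. *)
Definition stepb (G : nat -> nat -> seq nat -> seq nat -> nat -> bool)
    (v j : nat) (M r : seq nat) (c : nat) : bool :=
  [&& j == 0, validb v M & all (fun p => nth 0 r p == 0) (iota 0 t.+1)] ||
  has (fun y => (j == y.+1) &&
    (parb y v && joinb G v y M r c || ~~ parb y v && G v y M r c)) (iota 0 N).

End Step.

Lemma all_iotaP (P : pred nat) k : reflect (forall i, i < k -> P i) (all P (iota 0 k)).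
Proof.
apply: (iffP allP) => h i; first by move=> hi; apply: h; rewrite mem_iota; lia.
by rewrite mem_iota => hi; apply: h; lia.
Qed.

Lemma has_iotaP (P : pred nat) k : reflect (exists2 i, i < k & P i) (has P (iota 0 k)).
Proof.
apply: (iffP hasP) => -[i hi hP]; exists i => //; first by rewrite mem_iota in hi; lia.
by rewrite mem_iota; lia.
Qed.

Section Correctness.
Variables (t n N : nat) (E : rel nat) (tau : nat -> int).
Hypothesis Ebnd : forall x y, E x y -> y < n.
Hypothesis Esym : symmetric E.
Hypothesis peo : forall v x y, v < x -> v < y -> E v x -> E v y -> x != y -> E x y.
Hypothesis tau_t : forall u, u < n -> (tau u <= Posz t)%R.
Hypothesis hN : n + t < N.

Variable tle : nat -> nat -> bool.
Hypothesis tleE : forall u b, u < n -> b < N -> tle u b = (tau u <= Posz b)%R.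
Local Notation cnt := (cnt n).
Local Notation W := (W n E).
Local Notation par := (par n E).
Local Notation isB := (inB n E).
Local Notation isK := (inK E).
Local Notation valid := (validb t n E).

Lemma parbE y v : v <= n -> parb n N E y v = (par y == v).
Proof.
move=> hv; apply/idP/eqP => [|<-].
  case/orP=> [/andP[/andP[h1 h2] /all_iotaP h3]|/andP[/eqP-> /all_iotaP h]].
    apply/eqP; rewrite eqn_leq par_min //=; rewrite leqNgt; apply/negP => lt.
    have lt' : par y < n by lia.
    by have := h3 (par y); rewrite lt inK_par //= => /(_ _); lia.
  have := par_leq n E y; rewrite leq_eqVlt => /orP[/eqP//|lt].
  by have := h (par y); rewrite inK_par //= => /(_ _); lia.
have := par_leq n E y; rewrite leq_eqVlt => /orP[/eqP h|lt]; apply/orP; [right|left].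
  rewrite h eqxx /=; apply/all_iotaP => w _; apply/negP => /[dup] /(par_min Ebnd).
  by rewrite h => h1 /andP[_ /Ebnd]; lia.
rewrite lt inK_par //=; apply/all_iotaP => w _; apply/implyP => hw.
by apply/negP => /(par_min Ebnd); lia.
Qed.

(** Closure is asked only inside [Z], the region handled so far, whereas the count ranges over all
    neighbours; elsewhere [X] is arbitrary. *)
Definition closed (Z X : pred nat) : Prop := forall u, u < n -> Z u ->
  (tau u <= Posz (cnt (fun x => E u x && X x)))%R -> X u.

Lemma closed_sub (Z Z' X : pred nat) :
  (forall u, Z' u -> Z u) -> closed Z X -> closed Z' X.
Proof. by move=> h hc u hu /h; exact: hc. Qed.

(** What a table entry promises. Quantifying over all closed [X] replaces the infection order, since
    statements about one [X] in two subtrees simply add up. [sem_full] takes care of the vertices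
    that must wait for the whole bag. *)
Record sem (v j : nat) (M r : seq nat) (D : pred nat) : Prop := Sem {
  sem_count : forall X, closed (W v j) X -> (forall x, D x -> X x) ->
    forall p, p <= t -> nth 0 M p < n -> (forall q, q < p -> X (nth 0 M q)) ->
    nth 0 r p <= cnt (fun x => [&& W v j x, E (nth 0 M p) x & X x]);
  sem_full : forall X, closed (W v j) X -> (forall x, D x -> X x) ->
    (forall x, isB v x -> X x) -> forall x, W v j x -> X x }.

Lemma validP v M : valid v M -> forall p, p <= t -> nth 0 M p < n ->
  isB v (nth 0 M p) /\ forall q, q < p -> nth 0 M q < n /\ nth 0 M q != nth 0 M p.
Proof.
move=> /all_iotaP h p hp hn; have := h p hp; rewrite hn /= => /andP[h1 /all_iotaP h2].
by split=> // q /h2/andP.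
Qed.

Lemma valid_inj v M p q : valid v M -> p <= t -> q <= t -> nth 0 M p < n ->
  nth 0 M p = nth 0 M q -> p = q.
Proof.
move=> hv hp hq hn hpq; case: (ltngtP p q) => // lt.
  have hn' : nth 0 M q < n by rewrite -hpq.
  by have [_ /(_ _ lt)[_]] := validP hv hq hn'; rewrite hpq eqxx.
by have [_ /(_ _ lt)[_]] := validP hv hp hn; rewrite hpq eqxx.
Qed.

Lemma valid_leq_cnt v M i (P : pred nat) : valid v M -> i <= t.+1 ->
  (forall q, q < i -> nth 0 M q < n /\ P (nth 0 M q)) -> i <= cnt P.
Proof.
move=> hv hi h; rewrite -[X in X <= _](size_iota 0) -(size_map (nth 0 M)).
apply: size_leq_cnt.
  rewrite map_inj_in_uniq ?iota_uniq // => p q; rewrite !mem_iota => hp hq.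
  by apply: (valid_inj hv); try lia; have [] := h p; lia.
by move=> x /mapP[q]; rewrite mem_iota => hq ->; apply: h; lia.
Qed.

Lemma mem_inK y M p : valid y M -> p <= t -> nth 0 M p < n ->
  nth 0 M p != y -> isK y (nth 0 M p).
Proof.
move=> hv hp hn ne; have [/orP[/andP[_ h]|//] _] := validP hv hp hn.
by rewrite h in ne.
Qed.

(** * Soundness: attaching the subtree of one child *)

Section Join.
Variables (v y : nat) (M r1 M' r' : seq nat) (D1 D' : pred nat) (b : bool).
Hypotheses (hy : y < n) (hpar : par y = v).
Hypotheses (vM : valid v M) (vM' : valid y M').
Hypotheses (s1 : sem v y M r1 D1) (s' : sem y y M' r' D').
Hypothesis hdone : b \/ doneb t n N tle y M' r'.

Let D := [pred x | [|| D1 x, D' x | b && (x == y)]].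

(** The first alternative of the premise serves [sem_full], the second the counts. If [y] is in slot
    [i], its [i] predecessors are neighbours in the bag, and [nth 0 r' i] more lie below it. If [y]
    is in no slot, the clique provides [t.+1] neighbours. *)
Lemma join_infects X : closed (W v y.+1) X -> (forall x, D x -> X x) ->
  ((forall x, isK y x -> X x) \/
   exists2 i, i <= t & nth 0 M' i = y /\ forall q, q < i -> X (nth 0 M' q)) ->
  X y.
Proof.
move=> hc hD hpre.
case: hdone => [hb|hd]; first by apply: hD; rewrite /= hb eqxx !orbT.
have Wy : W v y.+1 y by rewrite (WS_join _ hy hpar) eqxx !orbT.
have hcy : closed (W y y) X.
  by apply: closed_sub hc => u hu; rewrite (WS_join _ hy hpar) hu orbT.
have hD' x : D' x -> X x by move=> hx; apply: hD; rewrite /= hx orbT.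
case/orP: hd => [/has_iotaP[i hi /andP[/eqP hiy /has_iotaP[a ha /andP[ha1 ha2]]]]|/all_iotaP hall].
- have hpred q : q < i -> nth 0 M' q < n /\ (isK y (nth 0 M' q) && X (nth 0 M' q)).
    have hin : nth 0 M' i < n by rewrite hiy.
    move=> hq; have [_ /(_ q hq)[h1 h2]] := validP vM' hi hin.
    have hK : isK y (nth 0 M' q) by apply: (mem_inK vM'); rewrite // -?hiy //; lia.
    rewrite hK; split=> //=; case: hpre => [|[i' hi' [hi'y]]]; first exact.
    have <- : i = i' by apply: (valid_inj vM'); rewrite ?hiy ?hi'y //; lia.
    by apply.
  rewrite tleE // in ha2; apply: hc => //; apply: (le_trans ha2); rewrite lez_nat; apply: (leq_trans ha1).
  have c1 : i <= cnt (fun x => isK y x && X x).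
    by apply: (valid_leq_cnt vM') => //; lia.
  have c2 : nth 0 r' i <= cnt (fun x => [&& W y y x, E y x & X x]).
    have := sem_count s' hcy hD' hi; rewrite hiy; apply=> // q.
    by case/hpred=> _ /andP[].
  apply: (leq_trans (leq_add c1 c2)); rewrite -cnt_or_disj; last first.
    by move=> x _; apply/negP => /andP[/andP[/andP[h1 _] _] /andP[/W_ltj]]; lia.
  by apply: leq_cnt => x _ /orP[/andP[/andP[_ ->] ->//]|/and3P[_ -> ->]].
- case: hpre => [hK|[i hi [hiy _]]]; last by have := hall i hi; rewrite hiy eqxx andbF.
  apply: hc => //; apply: (le_trans (tau_t hy)); rewrite lez_nat.
  apply: leq_trans (leqnSn _) _; apply: (valid_leq_cnt vM') => // q hq.
  have /andP[h1 h2] := hall q hq.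
  have h3 : isK y (nth 0 M' q) by apply: (mem_inK vM').
  by rewrite (hK _ h3); case/andP: h3 => _ ->.
Qed.

Lemma join_sem r : all (contribb t n y M r r1 M' r') (iota 0 t.+1) ->
  sem v y.+1 M r D.
Proof.
move=> /all_iotaP hcon; split=> X hc hD.
  have hc1 : closed (W v y) X.
    by apply: closed_sub hc => u hu; rewrite (WS_join _ hy hpar) hu.
  have hcy : closed (W y y) X.
    by apply: closed_sub hc => u hu; rewrite (WS_join _ hy hpar) hu orbT.
  have hD1 x : D1 x -> X x by move=> hx; apply: hD; rewrite /= hx.
  have hD' x : D' x -> X x by move=> hx; apply: hD; rewrite /= hx orbT.
  move=> p hp hn hpre; set m := nth 0 M p in hn *.
  have c1 := sem_count s1 hc1 hD1 hp hn hpre; rewrite -/m in c1.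
  have -> : cnt (fun x => [&& W v y.+1 x, E m x & X x]) =
      cnt (fun x => [&& W v y x, E m x & X x]) +
      (cnt (fun x => [&& W y y x, E m x & X x]) + cnt (fun x => [&& x == y, E m x & X x])).
    rewrite -cnt_or_disj => [|x _]; last first.
      by apply/negP => /andP[/andP[/W_ltj h1 _] /andP[/eqP h2 _]]; lia.
    rewrite -cnt_or_disj => [|x _]; last first.
      apply/negP => /andP[/andP[/(W_disj hy hpar)[/negbTE h1 /negbTE h2] _]].
      by rewrite h1 h2.
    apply: eq_cnt => x _; rewrite (WS_join _ hy hpar).
    by case: (W v y x); case: (W y y x); case: (x == y); case: (E m x && X x).
  case/orP: (hcon p hp) => [h|]; first by lia.
  case/has_iotaP=> q hq /and4P[/eqP hqm _ /all_iotaP hpq hr]; rewrite -/m in hqm.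
  (* If [y] precedes slot [q], the slots of [M'] before [y] all occur before slot [p] of [M], hence
     lie in [X], and [join_infects] applies. *)
  have Xy : has (fun q' => nth 0 M' q' == y) (iota 0 q) -> X y.
    case/has_iotaP=> i hi /eqP hiy; apply: join_infects => //; right.
    exists i; first by lia.
    split=> // q' hq'; have := hpq q' (ltn_trans hq' hi).
    case/orP=> [/eqP hq'y|/has_iotaP[p' hp' /eqP<-]]; last exact: hpre.
    have : q' = i by apply: (valid_inj vM'); rewrite ?hq'y ?hiy //; lia.
    by lia.
  have c2 : nth 0 r' q <= cnt (fun x => [&& W y y x, E m x & X x]).
    rewrite -hqm; apply: (sem_count s') => //; rewrite ?hqm // => q' hq'.
    case/orP: (hpq q' hq') => [/eqP hq'y|/has_iotaP[p' hp' /eqP<-]]; last exact: hpre.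
    by rewrite hq'y; apply: Xy; apply/has_iotaP; exists q'; rewrite ?hq'y.
  case/orP: hr => [h|/andP[h hy']]; first by lia.
  (* The bag of [v] lies above [y], so [m] differs from [y]; sitting in a slot of [M'], it is then a
     neighbour of [y]. *)
  suff -> : cnt (fun x => [&& x == y, E m x & X x]) = 1 by lia.
  rewrite -(cnt_pred1 hy); apply: eq_cnt => x _ /=.
  case: eqP => //= ->; rewrite (Xy hy') andbT.
  have /andP[_] : isK y m; last by rewrite Esym.
  rewrite -hqm; apply: (mem_inK vM'); rewrite ?hqm //.
  have [hB _] := validP vM hp hn; rewrite -/m in hB.
  apply/eqP => my; rewrite my in hB.
  have := par_gt E hy; rewrite hpar.
  by case/orP: hB => [/andP[_ /eqP->]|/andP[]]; lia.
move=> hB x.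
have hK x' : isK y x' -> X x' by move=> h; apply: hB; rewrite -hpar; apply: (inK_sub Ebnd peo).
have Xy : X y by apply: join_infects => //; left.
rewrite (WS_join _ hy hpar) => /or3P[h|h|/eqP->//].
  apply: (sem_full s1) h => //.
    by apply: closed_sub hc => u hu; rewrite (WS_join _ hy hpar) hu.
  by move=> z hz; apply: hD; rewrite /= hz.
apply: (sem_full s') h.
- by apply: closed_sub hc => u hu; rewrite (WS_join _ hy hpar) hu orbT.
- by move=> z hz; apply: hD; rewrite /= hz orbT.
- by move=> z /orP[/andP[_ /eqP->//]|]; exact: hK.
Qed.

End Join.

Definition fits (M : seq nat) : bool := (size M == t.+1) && all (fun x => x < N) M.

Variable G : nat -> nat -> seq nat -> seq nat -> nat -> bool.
Hypothesis Gstep : forall v j M r c, v <= n -> j <= n -> fits M -> fits r -> c < N ->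
  G v j M r c = stepb t n N E tle G v j M r c.

(** The outer induction is on [v], because a join at [v] consults the full subtree of a child
    [y < v]; the inner one adds the children in turn. *)
Lemma dp_sound v j M r c : v <= n -> j <= n -> fits M -> fits r -> c < N ->
  G v j M r c -> valid v M /\ exists2 D : pred nat, sem v j M r D & cnt D <= c.
Proof.
have [k] := ubnP v; elim: k v j M r c => // k IHv v j M r c hk hv.
elim: j M r c => [|y IHj] M r c hj fM fr hc; rewrite Gstep //.
  case/orP=> [/and3P[_ hvM /all_iotaP h0]|/has_iotaP[z _ /andP[]//]].
  split=> //; exists pred0; last by rewrite /cnt count_pred0.
  split=> [X _ _ p hp _ _|X _ _ _ x]; first by rewrite (eqP (h0 p hp)).
  by rewrite W0.
case/orP=> [/and3P[//]|/has_iotaP[z _ /andP[/eqP[<-] {z}]]].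
rewrite parbE //; case/orP=> [/andP[/eqP hpar]|/andP[hpar hG]]; last first.
  have [hvM [D [h1 h2] hD]] := IHj M r c (ltnW hj) fM fr hc hG.
  split=> //; exists D => //; split=> X hcl.
    move=> hDX p hp hn hpre.
    have E1 u : W v y.+1 u = W v y u by apply: WS_skip.
    rewrite (eq_cnt (Q := fun x => [&& W v y x, E (nth 0 M p) x & X x])) => [|x _].
      by apply: h1 => //; apply: closed_sub hcl => u; rewrite E1.
    by rewrite E1.
  move=> hDX hB x; rewrite (WS_skip _ hpar) // => hx; apply: h2 hx => //.
  by apply: closed_sub hcl => u; rewrite (WS_skip _ hpar).
case/exsP=> r1 [sr1 ar1 /exsP[M' [sM' aM' /exsP[r' [sr' ar']]]]].
case/has_iotaP=> c1 hc1 /has_iotaP[c' hc' /and4P[G1 G' hcost hcon]].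
have fr1 : fits r1 by rewrite /fits sr1 eqxx.
have fM' : fits M' by rewrite /fits sM' eqxx.
have fr' : fits r' by rewrite /fits sr' eqxx.
have hyv := par_gt E hj; rewrite hpar in hyv.
have [hvM [D1 s1 hD1]] := IHj M r1 c1 (ltnW hj) fM fr1 hc1 G1.
have hyk : y < k := leq_trans hyv hk.
have [vM' [D' s' hD']] := IHv y y M' r' c' hyk (ltnW hj) (ltnW hj) fM' fr' hc' G'.
split=> //.
(* [b] records which alternative of the cost condition holds: one unit is paid to put [y] into the
   set, or [y] is left to be infected. *)
have [b [hd hb]] : exists b : bool, (b \/ doneb t n N tle y M' r') /\ c1 + c' + b <= c.
  case/orP: hcost => [h|/andP[h1 h2]]; first by exists true; split; [left | rewrite addn1].
  by exists false; split; [right | rewrite addn0].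
exists [pred x | [|| D1 x, D' x | b && (x == y)]]; first exact: (join_sem hj hpar hvM vM' s1 s' hd hcon).
apply: leq_trans hb; apply: leq_trans (leq_cnt_or _ _ _) _.
rewrite -addnA leq_add //; apply: leq_trans (leq_cnt_or _ _ _) _.
rewrite leq_add //; case: b {hd} => /=; last by rewrite /cnt count_pred0.
by rewrite -(cnt_pred1 hj).
Qed.

(** * Completeness: entries read off a given infection order *)

Section Complete.
Variables (D : pred nat) (T : nat -> nat).
Hypothesis T_inj : forall x y, x < n -> y < n -> T x = T y -> x = y.
Hypothesis D_T : forall u, u < n -> ~~ D u ->
  (tau u <= Posz (cnt (fun x => E u x && (T x < T u)%N)))%R.

Definition bag (v : nat) : seq nat :=
  sort (fun x y => T x <= T y) (filter (isB v) (iota 0 n)).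
Definition slots (v : nat) : seq nat := mkseq (nth n (bag v)) t.+1.
Definition early (v j m : nat) : nat := cnt (fun x => [&& W v j x, E m x & T x < T m]).
Definition counts (v j : nat) : seq nat :=
  mkseq (fun p => minn (t - p) (early v j (nth n (bag v) p))) t.+1.

Lemma inB_lt v x : isB v x -> x < n.
Proof. by case/orP=> [/andP[h /eqP->//]|/andP[_ /Ebnd]]. Qed.

Lemma mem_bag v x : (x \in bag v) = isB v x.
Proof.
rewrite mem_sort mem_filter mem_iota /=; case: (boolP (isB v x)) => //= /inB_lt.
by rewrite add0n.
Qed.

Lemma bag_uniq v : uniq (bag v).
Proof. by rewrite sort_uniq filter_uniq // iota_uniq. Qed.

Lemma nth_bag v p : p < size (bag v) -> isB v (nth n (bag v) p).
Proof. by move=> h; rewrite -mem_bag mem_nth. Qed.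

Lemma nth_bag_lt v p : (nth n (bag v) p < n) = (p < size (bag v)).
Proof.
case: (ltnP p (size (bag v))) => h; first by rewrite (inB_lt (nth_bag h)).
by rewrite nth_default ?ltnn.
Qed.

Lemma bag_mono v p q : p < q -> q < size (bag v) ->
  T (nth n (bag v) p) < T (nth n (bag v) q).
Proof.
move=> pq hq; have hp := ltn_trans pq hq; rewrite ltn_neqAle; apply/andP; split.
  apply/eqP => /T_inj H; have /eqP := H (inB_lt (nth_bag hp)) (inB_lt (nth_bag hq)).
  by rewrite nth_uniq ?bag_uniq //; lia.
have tr : transitive (fun x y => T x <= T y) by move=> y x z; exact: leq_trans.
have so : sorted (fun x y => T x <= T y) (bag v).
  by apply: sort_sorted => x y; exact: leq_total.
exact: (sorted_ltn_nth tr n so p q hp hq pq).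
Qed.

Lemma bag_before v p x : p < size (bag v) -> isB v x -> T x < T (nth n (bag v) p) ->
  exists2 q, q < p & nth n (bag v) q = x.
Proof.
move=> hp; rewrite -mem_bag => hx lt; exists (index x (bag v)); last exact: nth_index.
rewrite ltnNge; apply/negP => le.
have hi : index x (bag v) < size (bag v) by rewrite index_mem.
move: le; rewrite leq_eqVlt => /orP[/eqP E1|lt'].
  by move: lt; rewrite E1 nth_index // ltnn.
by have := bag_mono lt' hi; rewrite nth_index //; lia.
Qed.

Lemma bag_rank v p : p < size (bag v) ->
  cnt (fun x => isB v x && (T x < T (nth n (bag v) p))) = p.
Proof.
move=> hp; set m := nth n (bag v) p.
transitivity (count (fun x => T x < T m) (bag v)).
  by rewrite count_sort count_filter; apply: eq_count => x /=; rewrite andbC.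
rewrite -[in LHS](cat_take_drop p (bag v)) count_cat.
have -> : count (fun x => T x < T m) (drop p (bag v)) = 0.
  apply/eqP; rewrite -leqn0 leqNgt -has_count -all_predC; apply/(all_nthP n) => i.
  rewrite size_drop nth_drop /= => hi.
  case: i hi => [|i] hi; first by rewrite addn0 -/m ltnn.
  by have := @bag_mono v p (p + i.+1); rewrite -/m; lia.
rewrite addn0; have : size (take p (bag v)) = p by rewrite size_take hp.
move=> {2}<-; apply/eqP; rewrite -all_count; apply/(all_nthP n) => i.
by rewrite size_take hp => hi; rewrite nth_take //; apply: bag_mono.
Qed.

Lemma nth_slots v p : p <= t -> nth 0 (slots v) p = nth n (bag v) p.
Proof. by move=> hp; rewrite nth_mkseq. Qed.

Lemma nth_counts v j p : p <= t ->
  nth 0 (counts v j) p = minn (t - p) (early v j (nth n (bag v) p)).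
Proof. by move=> hp; rewrite nth_mkseq. Qed.

Lemma fits_slots v : fits (slots v).
Proof.
rewrite /fits size_mkseq eqxx; apply/(all_nthP 0) => p; rewrite size_mkseq => hp.
rewrite nth_slots //; case: (ltnP p (size (bag v))) => h.
  by have := inB_lt (nth_bag h); lia.
by rewrite nth_default //; lia.
Qed.

Lemma fits_counts v j : fits (counts v j).
Proof.
rewrite /fits size_mkseq eqxx; apply/(all_nthP 0) => p; rewrite size_mkseq => hp.
by rewrite nth_counts //; lia.
Qed.

Lemma early_blank v j : early v j n = 0.
Proof.
rewrite /early -[RHS](count_pred0 (iota 0 n)); apply: eq_cnt => x _ /=.
by case h: (E n x); rewrite ?andbF //; move: h; rewrite Esym => /Ebnd; rewrite ltnn.
Qed.

Lemma cnt_leq (P : pred nat) : cnt P <= n.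
Proof. by rewrite -[X in _ <= X](size_iota 0) count_size. Qed.

Lemma valid_slots v : valid v (slots v).
Proof.
apply/all_iotaP => p hp; rewrite nth_slots // nth_bag_lt; apply/implyP => hs.
rewrite nth_bag //=; apply/all_iotaP => q hq; rewrite nth_slots; last by lia.
have hqs := ltn_trans hq hs; rewrite nth_bag_lt hqs nth_uniq ?bag_uniq //=.
by apply/eqP => E1; rewrite E1 ltnn in hq.
Qed.

(** The neighbours of [y] above it form the rest of its bag, of which [i] are earlier in time; those
    below it all lie in its subtree, by [lower_nbr]. *)
Lemma early_self y i : y < n -> i < size (bag y) -> nth n (bag y) i = y ->
  cnt (fun x => E y x && (T x < T y)) = i + early y y y.
Proof.
move=> hy hi hiy; rewrite -[X in X + _](bag_rank hi) hiy -cnt_or_disj; last first.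
  move=> x _; apply/negP => /andP[/andP[hB _] /and3P[/W_ltj lt _ _]].
  by case/orP: hB => [/andP[_ /eqP]|/andP[]]; lia.
apply: eq_cnt => x hx; case hT: (T x < T y); last by rewrite !andbF.
rewrite !andbT; case: (ltngtP x y) => [lt|lt|E1]; last by rewrite E1 ltnn in hT.
- have -> : isB y x = false by apply/negP => /orP[/andP[_ /eqP]|/andP[]]; lia.
  case: (boolP (E y x)) => h; rewrite ?andbF //= andbT.
  by rewrite (lower_nbr Ebnd peo lt) // Esym.
- have -> : W y y x = false by apply/negP => /W_ltj; lia.
  by rewrite orbF /inB /inK lt; case: eqP => [|_]; [lia | rewrite andbF].
Qed.

Lemma done_slots y : y < n -> ~~ D y -> doneb t n N tle y (slots y) (counts y y).
Proof.
move=> hy hD; have : y \in bag y by rewrite mem_bag /inB hy eqxx.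
move=> hb; have hi : index y (bag y) < size (bag y) by rewrite index_mem.
have hiy := nth_index n hb; move: (index y (bag y)) hi hiy => i hi hiy.
apply/orP; case: (leqP i t) => hit; [left|right].
  apply/has_iotaP; exists i => //; rewrite nth_slots // hiy eqxx /= nth_counts // hiy.
  (* This sum is either [t], which meets every threshold, or the exact number of earlier neighbours
     of [y]. *)
  apply/has_iotaP; exists (i + minn (t - i) (early y y y)); first by lia.
  rewrite leqnn /= tleE //; last by lia.
  have := D_T hy hD; rewrite (early_self hy hi hiy).
  by have := tau_t hy; lia.
apply/all_iotaP => p hp; rewrite nth_slots // nth_bag_lt.
have ip : p < i by lia.
have hs := ltn_trans ip hi; rewrite -[X in _ != X]hiy hs nth_uniq ?bag_uniq //=.
by rewrite neq_ltn ip.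
Qed.

(** Apart from [y], the bag of [y] is contained in that of [v]. So the position [q] of a common
    vertex [m] in the former exceeds its position [p] in the latter by at most one, and only if [y]
    is earlier than [m]. The caps obey the same inequality: [t - p] exceeds [t - q] by at most one,
    and only then. Hence capped counts add up as true ones do. *)
Lemma contrib_slots v y p : y < n -> par y = v -> p <= t ->
  contribb t n y (slots v) (counts v y.+1) (counts v y) (slots y) (counts y y) p.
Proof.
move=> hy hpar hp; rewrite /contribb !nth_counts //.
case: (ltnP p (size (bag v))) => hs; last first.
  by rewrite nth_default // !early_blank leqnn.
set m := nth n (bag v) p; have hm : isB v m by exact: nth_bag.
have hmn := inB_lt hm.
have hym : y < m.
  by have := par_gt E hy; rewrite hpar; case/orP: hm => [/andP[_ /eqP->]|/andP[]]; lia.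
have hearly : early v y.+1 m = early v y m + (early y y m + (E m y && (T y < T m))).
  rewrite /early -[nat_of_bool _](_ : cnt (fun x => [&& x == y, E m x & T x < T m]) = _); last first.
    case: (boolP (E m y && _)) => h.
      by rewrite -[RHS](cnt_pred1 hy); apply: eq_cnt => x _ /=; case: eqP => //= ->.
    rewrite -[RHS](count_pred0 (iota 0 n)); apply: eq_cnt => x _ /=.
    by case: eqP => //= ->; apply/negbTE.
  rewrite -cnt_or_disj => [|x _]; last first.
    by apply/negP => /andP[/andP[/W_ltj h1 _] /andP[/eqP h2 _]]; lia.
  rewrite -cnt_or_disj => [|x _]; last first.
    apply/negP => /andP[/andP[/(W_disj hy hpar)[/negbTE h1 /negbTE h2] _]].
    by rewrite h1 h2.
  apply: eq_cnt => x _; rewrite (WS_join _ hy hpar).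
  by case: (W v y x); case: (W y y x); case: (x == y); case: (E m x && _).
(* If [m] is not a later neighbour of [y], it has no neighbour in the subtree of [y] either, and the
   count does not change. *)
case: (boolP (isK y m)) => hK; last first.
  have h1 : E m y = false.
    by apply/negbTE; move: hK; rewrite /inK hym Esym.
  have h2 : early y y m = 0.
    rewrite /early -[RHS](count_pred0 (iota 0 n)); apply: eq_cnt => x _ /=.
    apply/negbTE; apply: contra hK => /and3P[hW hE _].
    by apply: (W_nbr Ebnd Esym peo hW) => //; rewrite Esym.
  by rewrite hearly h1 h2 !addn0 leqnn.
have Emy : E m y by rewrite Esym; case/andP: hK.
rewrite Emy /= in hearly.
have hb : m \in bag y by rewrite mem_bag /inB hK orbT.
have hq : index m (bag y) < size (bag y) by rewrite index_mem.
have hqm := nth_index n hb; move: (index m (bag y)) hq hqm => q hq hqm.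
have qp : q <= p + (T y < T m).
  rewrite -[X in X <= _](bag_rank hq) -[X in _ <= X + _](bag_rank hs) hqm -/m.
  apply: (@leq_trans (cnt (fun x => (isB v x && (T x < T m)) || ((x == y) && (T y < T m))))).
    apply: leq_cnt => x _ /andP[/orP[/andP[_ /eqP->]|hx] ->].
      by rewrite eqxx orbT.
    by rewrite -hpar (inK_sub Ebnd peo hx).
  apply: leq_trans (leq_cnt_or _ _ _) _; rewrite leq_add2l.
  case: (T y < T m); last by rewrite (eq_cnt (Q := pred0)) ?/cnt ?count_pred0 // => x _; rewrite andbF.
  by rewrite /= -(cnt_pred1 hy); apply: leq_cnt => x _; rewrite andbT.
(* If [m] falls outside the slots of [y], then [p] is at least [t] and the cap at slot [p] is 0. *)
case: (leqP q t) => hqt; last by rewrite (_ : t - p = 0) ?min0n //; lia.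
apply/orP; right; apply/has_iotaP; exists q => //.
rewrite !nth_slots // hqm eqxx hmn /= nth_counts // hqm hearly; apply/andP; split.
  apply/all_iotaP => q' hq'; rewrite nth_slots; last by lia.
  have lt := bag_mono hq' hq; rewrite hqm in lt.
  have hB := nth_bag (ltn_trans hq' hq).
  case/orP: hB => [/andP[_ ->//]|hB]; apply/orP; right.
  have hBv : isB v (nth n (bag y) q') by rewrite -hpar (inK_sub Ebnd peo hB).
  have [p' hp' hpp] := bag_before hs hBv lt.
  by apply/has_iotaP; exists p' => //; rewrite nth_slots ?hpp //; lia.
case hT: (T y < T m) qp hearly => /= qp hearly; apply/orP; [right|left]; last by lia.
apply/andP; split; first by lia.
have hBy : isB y y by rewrite /inB hy eqxx.
have hT' : T y < T (nth n (bag y) q) by rewrite hqm.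
have [q' hq' hqy] := bag_before hq hBy hT'.
by apply/has_iotaP; exists q' => //; rewrite nth_slots ?hqy //; lia.
Qed.

Lemma dp_complete v j : v <= n -> j <= n ->
  G v j (slots v) (counts v j) (cnt (fun x => W v j x && D x)).
Proof.
have cN (P : pred nat) : cnt P < N by have := cnt_leq P; lia.
have [k] := ubnP v; elim: k v j => // k IHv v j hk hv.
elim: j => [|y IHj] hj; rewrite Gstep ?fits_slots ?fits_counts ?cN //; apply/orP.
  left; rewrite eqxx valid_slots; apply/all_iotaP => p hp; rewrite nth_counts //.
  suff -> : early v 0 (nth n (bag v) p) = 0 by rewrite minn0.
  by rewrite /early -[RHS](count_pred0 (iota 0 n)); apply: eq_cnt => x _; rewrite W0.
right; apply/has_iotaP; exists y; first by lia.
rewrite eqxx parbE //=; case: (par y =P v) => hpar /=; last first.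
  have E1 u : W v y.+1 u = W v y u by apply: WS_skip; apply/eqP.
  have -> : counts v y.+1 = counts v y.
    apply: (@eq_from_nth _ 0); rewrite ?size_mkseq // => p hp.
    by rewrite !nth_counts //; congr minn; apply: eq_cnt => x _; rewrite E1.
  rewrite (eq_cnt (Q := fun x => W v y x && D x)) => [|x _]; last by rewrite E1.
  by apply: IHj; lia.
have hyv := par_gt E hj; rewrite hpar in hyv.
rewrite orbF; apply/exsP; exists (counts v y).
have /andP[/eqP-> ->] := fits_counts v y; split=> //.
apply/exsP; exists (slots y); have /andP[/eqP-> ->] := fits_slots y; split=> //.
apply/exsP; exists (counts y y); have /andP[/eqP-> ->] := fits_counts y y; split=> //.
apply/has_iotaP; exists (cnt (fun x => W v y x && D x)); first exact: cN.
apply/has_iotaP; exists (cnt (fun x => W y y x && D x)); first exact: cN.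
apply/and4P; split.
- by apply: IHj; lia.
- by apply: IHv; lia.
- have -> : cnt (fun x => W v y.+1 x && D x) = cnt (fun x => W v y x && D x) +
      (cnt (fun x => W y y x && D x) + D y).
    rewrite -[nat_of_bool _](_ : cnt (fun x => (x == y) && D x) = _); last first.
      case: (boolP (D y)) => h.
        by rewrite -[RHS](cnt_pred1 hj); apply: eq_cnt => x _ /=; case: eqP => //= ->.
      rewrite -[RHS](count_pred0 (iota 0 n)); apply: eq_cnt => x _ /=.
      by case: eqP => //= ->; apply/negbTE.
    rewrite -cnt_or_disj => [|x _]; last first.
      by apply/negP => /andP[/andP[/W_ltj h1 _] /andP[/eqP h2 _]]; lia.
    rewrite -cnt_or_disj => [|x _]; last first.
      apply/negP => /andP[/andP[/(W_disj hj hpar)[/negbTE h1 /negbTE h2] _]].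
      by rewrite h1 h2.
    apply: eq_cnt => x _; rewrite (WS_join _ hj hpar).
    by case: (W v y x); case: (W y y x); case: (x == y); case: (D x).
  case: (boolP (D y)) => hD /=; first by rewrite !addnA addn1 leqnn.
  by rewrite addn0 leqnn done_slots // orbT.
- by apply/all_iotaP => p hp; apply: contrib_slots.
Qed.

End Complete.

End Correctness.

(** * The table entries *)

Lemma computable_imply d P Q : computable d P -> computable d Q ->
  computable d (fun c s => P c s ==> Q c s).
Proof.
move=> hP hQ; apply: (@computable_ext _ (fun c s => ~~ P c s || Q c s)).
  by move=> c s _; rewrite implybE.
by apply: computable_or => //; apply: computable_not.
Qed.

Lemma terms_slice d i k : i + k <= d -> terms d k (fun _ s => take k (drop i s)).
Proof.
move=> h; exists [seq [:: Av j] | j <- iota i k].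
  by rewrite all_map; apply/allP => j; rewrite mem_iota /= andbT; lia.
split=> [|c s hs]; first by rewrite size_map size_iota.
have sz : size (take k (drop i s)) = k by rewrite size_takel // size_drop; lia.
rewrite -map_comp; apply: (@eq_from_nth _ 0); rewrite sz ?size_map ?size_iota //.
move=> j hj; rewrite nth_take // nth_drop (nth_map 0) ?size_iota //.
by rewrite nth_iota //= tmval1.
Qed.

(** The row of the larger end is always the one asked for, since only that half of the matrix is
    guaranteed to be intact. *)
Definition adj (c : ctx) (x y : nat) : bool :=
  (y < x) && (x < cn c) && cE c x y || (x < y) && (y < cn c) && cE c y x.

Lemma computable_adj d f g : term d f -> term d g ->
  computable d (fun c s => adj c (f c s) (g c s)).
Proof.
move=> hf hg; apply: computable_or; apply: computable_edge => //.
- by apply: computable_and; apply: computable_lt => //; exact: term_n.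
- by apply: computable_and; apply: computable_lt => //; exact: term_n.
Qed.

Section Formula.
Variable t : nat.

(** All cells share one arity; those with tags 0 to 2 have two genuine coordinates and are padded to
    the length of a cell of the dynamic program. *)
Definition pad : seq nat := nseq (t.+1 + t.+1 + 1) 0.
Arguments pad : simpl never.
Definition cell (c : ctx) (xs : seq nat) : bool := nth false (cT c) (idx (cN c) xs).
Definition look (tag : nat) (c : ctx) (x y : nat) : bool :=
  cell c (tag :: x :: y :: pad).
Definition lookG (c : ctx) (v j : nat) (M r : seq nat) (k : nat) : bool :=
  cell c (3 :: v :: j :: (M ++ (r ++ [:: k]))).

Definition simpb (c : ctx) (r u : nat) : bool :=
  [&& u < cn c, ~~ look 0 c r u &
    all (fun x => all (fun y =>
      [&& x < cn c, y < cn c, ~~ look 0 c r x, ~~ look 0 c r y, adj c u x, adj c u y & x != y]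
        ==> adj c x y) (iota 0 (cN c))) (iota 0 (cN c))].

(** A removal history: the cell [(r, v)] tells whether [v] is gone after [r] stages. Removing the
    simplicial vertex of least number makes the choice definable. *)
Definition elimb (c : ctx) (r v : nat) : bool :=
  has (fun r' => (r == r'.+1) && (look 0 c r' v ||
    simpb c r' v && all (fun u => (u < v) ==> ~~ simpb c r' u) (iota 0 (cN c))))
  (iota 0 (cN c)).

Definition rankb (c : ctx) (i u : nat) : bool := look 0 c i.+1 u && ~~ look 0 c i u.

Definition edgeb (c : ctx) (i j : nat) : bool :=
  [&& i < cn c, j < cn c &
    has (fun u => has (fun w => [&& rankb c i u, rankb c j w & adj c u w])
      (iota 0 (cN c))) (iota 0 (cN c))].

Definition threshb (c : ctx) (i b : nat) : bool :=
  (i < cn c) && has (fun u => (rankb c i u && (u < cn c)) && (ctau c u <= Posz b)%R) (iota 0 (cN c)).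

Definition adjT (c : ctx) (i j : nat) : bool := [&& i < cn c, j < cn c & look 1 c i j].
Definition tleT (c : ctx) : nat -> nat -> bool := look 2 c.

Definition stepT (c : ctx) (v j : nat) (M r : seq nat) (k : nat) : bool :=
  stepb t (cn c) (cN c) (adjT c) (tleT c) (lookG c) v j M r k.

(* The first coordinate of a cell is a tag: 0 for the elimination stages, 1 and 2
   for the edges and the thresholds of the graph relabelled by elimination rank,
   3 for the dynamic program. *)
Definition phi (c : ctx) (s : seq nat) : bool :=
  [|| (nth 0 s 0 == 0) && elimb c (nth 0 s 1) (nth 0 s 2),
      (nth 0 s 0 == 1) && edgeb c (nth 0 s 1) (nth 0 s 2),
      (nth 0 s 0 == 2) && threshb c (nth 0 s 1) (nth 0 s 2) |
      (nth 0 s 0 == 3) && stepT c (nth 0 s 1) (nth 0 s 2)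
        (take t.+1 (drop 3 s)) (take t.+1 (drop (3 + t.+1) s)) (nth 0 s (3 + t.+1 + t.+1))].

Definition arity : nat := 3 + (t.+1 + t.+1 + 1).

Definition ansb (c : ctx) (k : nat) : bool :=
  exs t.+1 (cN c) (fun M => exs t.+1 (cN c) (fun r => lookG c (cn c) (cn c) M r k)).

Definition outb (c : ctx) (s : seq nat) : bool :=
  ansb c (nth 0 s 0) &&
  all (fun k => (k < nth 0 s 0) ==> ~~ ansb c k) (iota 0 (cN c)).

(** Weakening below up to five quantifiers, the depth of [joinb]. *)
Ltac up1 := match goal with H : term _ _ |- _ => first
  [ exact: H | exact: (term_up _ H) | exact: (term_up _ (term_up _ H))
  | exact: (term_up _ (term_up _ (term_up _ H)))
  | exact: (term_up _ (term_up _ (term_up _ (term_up _ H))))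
  | exact: (term_up _ (term_up _ (term_up _ (term_up _ (term_up _ H))))) ] end.
Ltac ups := match goal with H : terms _ _ _ |- _ => first
  [ exact: H | exact: (terms_up _ H) | exact: (terms_up _ (terms_up _ H))
  | exact: (terms_up _ (terms_up _ (terms_up _ H)))
  | exact: (terms_up _ (terms_up _ (terms_up _ (terms_up _ H))))
  | exact: (terms_up _ (terms_up _ (terms_up _ (terms_up _ (terms_up _ H))))) ] end.

Lemma term_new1 d : term (d + 1) (fun _ s => nth 0 (drop d s) 0).
Proof. exact: (term_nth (isT : 0 < 1) (terms_new d 1)). Qed.

Lemma computable_look d tag f g : term d f -> term d g ->
  computable d (fun c s => look tag c (f c s) (g c s)).
Proof.
move=> hf hg; apply: computable_tab.
apply: terms_cons; first exact: term_const.
do 2 (apply: terms_cons => //).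
by apply: (@terms_nseq _ _ (fun _ _ => 0)); exact: term_const.
Qed.

Lemma computable_lookG d fv fj FM Fr fk : term d fv -> term d fj ->
  terms d t.+1 FM -> terms d t.+1 Fr -> term d fk ->
  computable d (fun c s => lookG c (fv c s) (fj c s) (FM c s) (Fr c s) (fk c s)).
Proof.
move=> hv hj hM hr hk; apply: computable_tab.
apply: terms_cons; first exact: term_const.
do 2 (apply: terms_cons => //).
apply: terms_cat hM _; apply: terms_cat hr _.
by apply: terms_cons => //; exact: terms_nil.
Qed.

Lemma computable_simp d f g : term d f -> term d g ->
  computable d (fun c s => simpb c (f c s) (g c s)).
Proof.
move=> hf hg; apply: computable_and; first by apply: computable_lt => //; exact: term_n.
apply: computable_and; first by apply: computable_not; apply: computable_look.
apply: computable_all1; apply: computable_all1.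
have hx : term (d + 1 + 1) (fun _ s => nth 0 (drop d (take (d + 1) s)) 0).
  exact: (term_up _ (term_new1 d)).
have hy := term_new1 (d + 1).
apply: computable_imply; last exact: computable_adj.
do 2 (apply: computable_and; first by apply: computable_lt => //; exact: term_n).
do 2 (apply: computable_and;
  first by apply: computable_not; apply: computable_look => //; up1).
do 2 (apply: computable_and; first by apply: computable_adj => //; up1).
exact: computable_neq.
Qed.

Lemma computable_elim d f g : term d f -> term d g ->
  computable d (fun c s => elimb c (f c s) (g c s)).
Proof.
move=> hf hg; apply: computable_ex1; have hr := term_new1 d.
apply: computable_and; first by apply: computable_eq; [up1 | exact: term_succ].
apply: computable_or; first by apply: computable_look => //; up1.
apply: computable_and; first by apply: computable_simp => //; up1.
apply: computable_all1; have hu := term_new1 (d + 1).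
apply: computable_imply; first by apply: computable_lt => //; up1.
by apply: computable_not; apply: computable_simp => //; up1.
Qed.

Lemma computable_rank d f g : term d f -> term d g ->
  computable d (fun c s => rankb c (f c s) (g c s)).
Proof.
move=> hf hg; apply: computable_and; first by apply: computable_look => //; exact: term_succ.
by apply: computable_not; apply: computable_look.
Qed.

Lemma computable_edgeb d f g : term d f -> term d g ->
  computable d (fun c s => edgeb c (f c s) (g c s)).
Proof.
move=> hf hg; do 2 (apply: computable_and; first by apply: computable_lt => //; exact: term_n).
apply: computable_ex1; apply: computable_ex1.
have hx : term (d + 1 + 1) (fun _ s => nth 0 (drop d (take (d + 1) s)) 0).
  exact: (term_up _ (term_new1 d)).
have hy := term_new1 (d + 1).
apply: computable_and; first by apply: computable_rank => //; up1.
apply: computable_and; first by apply: computable_rank => //; up1.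
exact: computable_adj.
Qed.

Lemma computable_threshb d f g : term d f -> term d g ->
  computable d (fun c s => threshb c (f c s) (g c s)).
Proof.
move=> hf hg; apply: computable_and; first by apply: computable_lt => //; exact: term_n.
apply: computable_ex1; have hx := term_new1 d.
apply: computable_tau => //; first by up1.
  apply: computable_and; first by apply: computable_rank => //; up1.
  by apply: computable_lt => //; exact: term_n.
by move=> c s _ /andP[].
Qed.

Lemma computable_adjT d f g : term d f -> term d g ->
  computable d (fun c s => adjT c (f c s) (g c s)).
Proof.
move=> hf hg; do 2 (apply: computable_and; first by apply: computable_lt => //; exact: term_n).
exact: computable_look.
Qed.

Lemma computable_inK d f g : term d f -> term d g ->
  computable d (fun c s => inK (adjT c) (f c s) (g c s)).
Proof.
by move=> hf hg; apply: computable_and; [exact: computable_lt | exact: computable_adjT].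
Qed.

Lemma computable_valid d f F : term d f -> terms d t.+1 F ->
  computable d (fun c s => validb t (cn c) (adjT c) (f c s) (F c s)).
Proof.
move=> hf hF; apply: computable_all => p; rewrite mem_iota => hp.
have hFp : term d (fun c s => nth 0 (F c s) p) by apply: term_nth hF; lia.
apply: computable_imply; first by apply: computable_lt => //; exact: term_n.
apply: computable_and.
  apply: computable_or; last exact: computable_inK.
  by apply: computable_and; [apply: computable_lt => //; exact: term_n | exact: computable_eq].
apply: computable_all => q; rewrite mem_iota => hq.
have hFq : term d (fun c s => nth 0 (F c s) q) by apply: term_nth hF; lia.
apply: computable_and; first by apply: computable_lt => //; exact: term_n.
exact: computable_neq.
Qed.

Lemma computable_done d f F F' : term d f -> terms d t.+1 F -> terms d t.+1 F' ->
  computable d (fun c s =>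
    doneb t (cn c) (cN c) (tleT c) (f c s) (F c s) (F' c s)).
Proof.
move=> hf hF hF'; apply: computable_or.
  apply: computable_has => p; rewrite mem_iota => hp.
  have hFp : term d (fun c s => nth 0 (F c s) p) by apply: term_nth hF; lia.
  have hFp' : term d (fun c s => nth 0 (F' c s) p) by apply: term_nth hF'; lia.
  apply: computable_and; first exact: computable_eq.
  apply: computable_ex1; have hb := term_new1 d.
  apply: computable_and; last by apply: computable_look => //; up1.
  by apply: computable_le => //; apply: term_add; [exact: term_const | up1].
apply: computable_all => p; rewrite mem_iota => hp.
have hFp : term d (fun c s => nth 0 (F c s) p) by apply: term_nth hF; lia.
apply: computable_and; last exact: computable_neq.
by apply: computable_lt => //; exact: term_n.
Qed.

Lemma computable_contrib d f F1 F2 F3 F4 F5 p : p < t.+1 -> term d f ->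
  terms d t.+1 F1 -> terms d t.+1 F2 -> terms d t.+1 F3 -> terms d t.+1 F4 ->
  terms d t.+1 F5 ->
  computable d (fun c s => contribb t (cn c) (f c s) (F1 c s) (F2 c s) (F3 c s)
    (F4 c s) (F5 c s) p).
Proof.
move=> hp hf h1 h2 h3 h4 h5.
have nthF F q : terms d t.+1 F -> q < t.+1 -> term d (fun c s => nth 0 (F c s) q).
  by move=> hF hq; apply: term_nth hF.
apply: computable_or; first by apply: computable_le; apply: nthF.
apply: computable_has => q; rewrite mem_iota => hq.
have {}hq : q < t.+1 by lia.
apply: computable_and; first by apply: computable_eq; apply: nthF.
apply: computable_and; first by apply: computable_lt; [apply: nthF | exact: term_n].
apply: computable_and.
  apply: computable_all => q'; rewrite mem_iota => hq'.
  have {}hq' : q' < t.+1 by lia.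
  apply: computable_or; first by apply: computable_eq => //; apply: nthF.
  apply: computable_has => p'; rewrite mem_iota => hp'.
  by apply: computable_eq; apply: nthF => //; lia.
apply: computable_or.
  by apply: computable_le; [apply: nthF | apply: term_add; apply: nthF].
apply: computable_and.
  by apply: computable_le; [apply: nthF | apply: term_succ; apply: term_add; apply: nthF].
apply: computable_has => q'; rewrite mem_iota => hq'.
by apply: computable_eq => //; apply: nthF => //; lia.
Qed.

Lemma computable_join d fv fy FM Fr fk : term d fv -> term d fy ->
  terms d t.+1 FM -> terms d t.+1 Fr -> term d fk ->
  computable d (fun c s => joinb t (cn c) (cN c) (tleT c) (lookG c)
    (fv c s) (fy c s) (FM c s) (Fr c s) (fk c s)).
Proof.
move=> hv hy hM hr hk.
apply: computable_exs; apply: computable_exs; apply: computable_exs.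
apply: computable_ex1; apply: computable_ex1.
have hr1 := terms_new d t.+1; have hM' := terms_new (d + t.+1) t.+1.
have hr' := terms_new (d + t.+1 + t.+1) t.+1.
have hc1 := term_new1 (d + t.+1 + t.+1 + t.+1).
have hc' := term_new1 (d + t.+1 + t.+1 + t.+1 + 1).
apply: computable_and; first by apply: computable_lookG; first [up1 | ups].
apply: computable_and; first by apply: computable_lookG; first [up1 | ups].
apply: computable_and.
  apply: computable_or.
    by apply: computable_le; [apply: term_succ; apply: term_add; up1 | up1].
  apply: computable_and; last by apply: computable_done; first [up1 | ups].
  by apply: computable_le; [apply: term_add; up1 | up1].
apply: computable_all => p; rewrite mem_iota => hp.
by apply: computable_contrib => //; first [up1 | ups].
Qed.

Lemma computable_par d f g : term d f -> term d g ->
  computable d (fun c s => parb (cn c) (cN c) (adjT c) (f c s) (g c s)).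
Proof.
move=> hf hg; apply: computable_or.
  apply: computable_and.
    by apply: computable_and; [apply: computable_lt => //; exact: term_n | exact: computable_inK].
  apply: computable_all1; have hw := term_new1 d.
  apply: computable_imply; first by apply: computable_lt => //; up1.
  by apply: computable_not; apply: computable_inK => //; up1.
apply: computable_and; first by apply: computable_eq => //; exact: term_n.
apply: computable_all1; have hw := term_new1 d.
by apply: computable_not; apply: computable_inK => //; up1.
Qed.

Lemma computable_step d fv fj FM Fr fk : term d fv -> term d fj ->
  terms d t.+1 FM -> terms d t.+1 Fr -> term d fk ->
  computable d (fun c s => stepT c (fv c s) (fj c s) (FM c s) (Fr c s) (fk c s)).
Proof.
move=> hv hj hM hr hk; apply: computable_or.
  apply: computable_and; first by apply: computable_eq => //; exact: term_const.
  apply: computable_and; first exact: computable_valid.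
  apply: computable_all => p; rewrite mem_iota => hp.
  by apply: computable_eq; [apply: term_nth hr; lia | exact: term_const].
apply: computable_ex1; have hy := term_new1 d.
apply: computable_and; first by apply: computable_eq; [up1 | exact: term_succ].
apply: computable_or; apply: computable_and.
- by apply: computable_par => //; up1.
- by apply: computable_join; first [up1 | ups].
- by apply: computable_not; apply: computable_par => //; up1.
- by apply: computable_lookG; first [up1 | ups].
Qed.

Lemma computable_phi : computable arity phi.
Proof.
have hv i : i < arity -> term arity (fun _ s => nth 0 s i) by exact: term_var.
have tagged k P : computable arity P ->
    computable arity (fun c s => (nth 0 s 0 == k) && P c s).
  move=> hP; apply: computable_and => //.
  by apply: computable_eq; [exact: hv | exact: term_const].
apply: computable_or; first by apply: tagged; apply: computable_elim; apply: hv.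
apply: computable_or; first by apply: tagged; apply: computable_edgeb; apply: hv.
apply: computable_or; first by apply: tagged; apply: computable_threshb; apply: hv.
apply: tagged; apply: computable_step; try (by apply: hv; rewrite /arity; lia).
- by apply: terms_slice; rewrite /arity; lia.
- by apply: terms_slice; rewrite /arity; lia.
Qed.

Lemma computable_ans d f : term d f -> computable d (fun c s => ansb c (f c s)).
Proof.
move=> hf; apply: computable_exs; apply: computable_exs.
have hM := terms_new d t.+1; have hr := terms_new (d + t.+1) t.+1.
by apply: computable_lookG; first [exact: term_n | up1 | ups].
Qed.

Lemma computable_out : computable 1 outb.
Proof.
have h0 : term 1 (fun _ s => nth 0 s 0) by exact: term_var.
apply: computable_and; first exact: computable_ans.
apply: computable_all1; have hk := term_new1 1.
apply: computable_imply; first by apply: computable_lt => //; up1.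
by apply: computable_not; apply: computable_ans.
Qed.

End Formula.

Arguments pad : simpl never.

(** * Dynamic monopolies and simplicial elimination *)

Section Hull.
Variables (T : finType) (e : rel T) (tau : T -> int).

Definition hull_closed (X : {set T}) : Prop :=
  forall u, (tau u <= Posz #|nbhd e u :&: X|)%R -> u \in X.

Lemma hull_step_mono D : {homo hull_step e tau D : X Y / X \subset Y}.
Proof.
move=> X Y sXY; apply: setUSS => //; apply/subsetP => u.
rewrite !inE => /orP[->//|h]; apply/orP; right; apply: le_trans h _.
by rewrite lez_nat subset_leq_card // setIS.
Qed.

(** A monotone operator on subsets of [T], iterated from the empty set, stabilises within [#|T|]
    rounds. *)
Lemma hullE D : hull e tau D = hull_step e tau D (hull e tau D).
Proof. by rewrite [LHS](esym (fixsetK (@hull_step_mono D))). Qed.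

Lemma hull_sub (D X : {set T}) : D \subset X -> hull_closed X -> hull e tau D \subset X.
Proof.
move=> sD hX; rewrite /hull; elim: #|T| => [|k IH]; first by rewrite sub0set.
rewrite /= subUset IH /=; apply/subsetP => u; rewrite inE => /orP[/(subsetP sD)//|h].
apply: hX; apply: le_trans h _.
by rewrite lez_nat subset_leq_card // setIS.
Qed.

(** The hull is the least closed superset of [D]. This form is free of rounds and matches the sets
    [X] in [sem]. *)
Lemma dyn_monopolyP (D : {set T}) : reflect
  (forall X : {set T}, D \subset X -> hull_closed X -> X = [set: T]) (dyn_monopoly e tau D).
Proof.
apply: (iffP eqP) => [h X sD hX|h].
  by apply/eqP; rewrite -subTset -h hull_sub.
apply: h; first by rewrite hullE; apply/subsetP => u hu; rewrite !inE hu orbT.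
by move=> u hu; rewrite hullE !inE hu !orbT.
Qed.

Lemma dyn_monopoly_setT : dyn_monopoly e tau [set: T].
Proof. by apply/dyn_monopolyP => X; rewrite subTset => /eqP. Qed.

Lemma dyn_min (D : {set T}) : dyn_monopoly e tau D -> dyn e tau <= #|D|.
Proof.
by rewrite /dyn; case: arg_minnP => [|D' _ h hD]; [exact: dyn_monopoly_setT | exact: h].
Qed.

Lemma dyn_attained : exists2 D : {set T}, dyn_monopoly e tau D & #|D| = dyn e tau.
Proof.
rewrite /dyn; case: arg_minnP => [|D hD _]; first exact: dyn_monopoly_setT.
by exists D.
Qed.

(** The time is the first round containing the vertex, and what infects it was present one round
    before. Ties are possible and are broken later. *)
Lemma infection_time D : dyn_monopoly e tau D -> exists f : T -> nat,
  forall u, u \notin D -> (tau u <= Posz #|[set w | e u w & (f w < f u)%N]|)%R.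
Proof.
move=> /eqP hD; pose S k := iter k (hull_step e tau D) set0.
have hS u : exists k, u \in S k.
  by exists #|T|; have : u \in hull e tau D by rewrite hD inE.
pose f u := ex_minn (hS u); exists f => u uD; rewrite /f.
case: (ex_minnP (hS u)) => -[|k]; first by rewrite inE.
rewrite /S /= -/(S k) => hu hmin.
have nu : u \notin S k by apply/negP => /hmin; rewrite ltnn.
move: hu; rewrite !inE (negbTE nu) (negbTE uD) /= => h.
apply: le_trans h _; rewrite lez_nat; apply: subset_leq_card.
apply/subsetP => w; rewrite !inE => /andP[-> hw] /=.
by case: ex_minnP => j _ /(_ _ hw).
Qed.

End Hull.

Lemma cnt_card n (P : pred nat) : cnt n P = #|[set i : 'I_n | P i]|.
Proof.
rewrite /cnt -val_enum_ord count_map enumT cardE size_filter.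
apply: eq_count => i; rewrite ?inE; reflexivity.
Qed.

Lemma min_right_end (T : finType) (f : T -> Rdefinitions.R) (S : {set T}) : S != set0 ->
  exists2 v, v \in S & forall x, x \in S -> Rdefinitions.Rle (f v) (f x).
Proof.
have [k] := ubnP #|S|; elim: k S => // k IH S hk /set0Pn[v hv].
have [/eqP S1|/IH[|w]] := boolP (S :\ v == set0).
- exists v => // x hx; have : x \notin S :\ v by rewrite S1 inE.
  by rewrite !inE hx andbT negbK => /eqP->; exact: RIneq.Rle_refl.
- by move: hk; rewrite (cardsD1 v S) hv; lia.
rewrite !inE => /andP[_ hw] hmin.
case: (RIneq.Rle_dec (f v) (f w)) => h.
  exists v => // x hx; case: (x =P v) => [->|/eqP nx]; first exact: RIneq.Rle_refl.
  by apply: RIneq.Rle_trans h (hmin x _); rewrite !inE nx.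
exists w => // x hx; case: (x =P v) => [->|/eqP nx].
  by apply: RIneq.Rlt_le; apply: RIneq.Rnot_le_lt.
by apply: hmin; rewrite !inE nx.
Qed.

(* The leftmost right end of an interval of [S] lies in all the neighbours of
   that interval in [S]. *)
Lemma interval_simplicial (T : finType) (e : rel T) (S : {set T}) :
  interval_graph e -> S != set0 -> exists2 v, v \in S & forall x y,
    x \in S -> y \in S -> v != x -> v != y -> e v x -> e v y -> x != y -> e x y.
Proof.
move=> [l [r [hlr he]]] /(min_right_end r)[v hv hmin]; exists v => // x y hx hy vx vy.
move=> /(he _ _ vx)[_ h1] /(he _ _ vy)[_ h2] xy; apply/(he _ _ xy).
by split; [apply: RIneq.Rle_trans h1 (hmin y hy) | apply: RIneq.Rle_trans h2 (hmin x hx)].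
Qed.

(** * Greedy elimination by the least simplicial vertex *)

Section Elimination.
Variables (n N : nat) (A : rel nat) (el : nat -> nat -> bool).
Hypothesis nN : n < N.

Definition simplicial (r u : nat) : bool :=
  [&& u < n, ~~ el r u &
    all (fun x => all (fun y =>
      [&& x < n, y < n, ~~ el r x, ~~ el r y, A u x, A u y & x != y]
        ==> A x y) (iota 0 N)) (iota 0 N)].

Hypothesis el0 : forall v, v < N -> el 0 v = false.
Hypothesis elS : forall r v, r < n -> v < N -> el r.+1 v =
  el r v || simplicial r v && all (fun u => (u < v) ==> ~~ simplicial r u) (iota 0 N).
Hypothesis exS : forall S : pred nat, (exists2 x, x < n & S x) -> exists2 v, v < n & S v /\
  forall x y, x < n -> y < n -> S x -> S y -> A v x -> A v y -> x != y -> A x y.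

Lemma el_mono r r' v : r <= r' -> r' <= n -> v < N -> el r v -> el r' v.
Proof.
move=> + hr' hv h; elim: r' hr' => [|r' IH] hr'; first by rewrite leqn0 => /eqP<-.
rewrite leq_eqVlt => /orP[/eqP<-//|hr]; rewrite elS // IH //; lia.
Qed.

Lemma new_uniq i u w : i < n -> u < N -> w < N -> el i.+1 u -> ~~ el i u ->
  el i.+1 w -> ~~ el i w -> u = w.
Proof.
move=> hi hu hw; rewrite !elS // => /orP[->//|/andP[su /all_iotaP mu]] _.
move=> /orP[->//|/andP[sw /all_iotaP mw]] _.
case: (ltngtP u w) => // lt.
  by have := mw u hu; rewrite lt su.
by have := mu w hw; rewrite lt sw.
Qed.

Lemma new_exists i : i < n -> (exists2 x, x < n & ~~ el i x) ->
  exists u, [/\ u < n, el i.+1 u & ~~ el i u].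
Proof.
move=> hi /(exS (S := fun x => ~~ el i x))[v hv [nv hsim]].
have : exists u, simplicial i u.
  exists v; rewrite /simplicial hv nv /=; apply/all_iotaP => x _; apply/all_iotaP => y _.
  by apply/implyP => /and5P[hx hy ex ey /and3P[vx vy xy]]; apply: hsim.
move=> hex; case: (ex_minnP hex) => u su mu; exists u.
have /and3P[hu nu _] := su; split=> //; rewrite elS //; last by lia.
rewrite su /=; apply/orP; right; apply/all_iotaP => w _; apply/implyP => lt.
by apply/negP => /mu; lia.
Qed.

(** Every nonempty remainder has a simplicial vertex, and taking the least one makes the removed
    vertex unique. Hence some vertex is left at each stage before [n]. *)
Lemma cnt_el i : i <= n -> cnt n (el i) = i.
Proof.
elim: i => [|i IH] hi.
  rewrite (eq_cnt (Q := pred0)) ?/cnt ?count_pred0 // => x hx.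
  by rewrite el0 //; lia.
have {}IH := IH (ltnW hi).
have [|u [hu h1 h2]] := @new_exists i hi.
  have : has (predC (el i)) (iota 0 n).
    rewrite has_predC all_count -/(cnt n (el i)) IH size_iota; apply/eqP; lia.
  by case/has_iotaP=> x hx h; exists x.
rewrite (eq_cnt (Q := fun x => el i x || pred1 u x)) => [|x hx].
  rewrite cnt_or_disj; first by rewrite IH cnt_pred1 // addn1.
  by move=> x _ /=; apply/negP => /andP[h /eqP E]; rewrite E (negbTE h2) in h.
apply/idP/orP => [h|[h|/= /eqP->//]]; last by apply: el_mono h => //; lia.
case: (boolP (el i x)) => h'; [by left | right].
by apply/eqP; apply: (@new_uniq i) => //; lia.
Qed.

Lemma elimination : exists f : 'I_n -> 'I_n, [/\ injective f,
  forall (i : 'I_n) u, u < N -> el i.+1 u && ~~ el i u = (u == f i :> nat) &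
  forall v x y : 'I_n, v < x -> v < y -> A (f v) (f x) -> A (f v) (f y) -> x != y ->
    A (f x) (f y)].
Proof.
have ex (i : 'I_n) : exists u : 'I_n, el i.+1 u && ~~ el i u.
  have hi := ltn_ord i; have [|u [hu h1 h2]] := @new_exists i hi.
    have : has (predC (el i)) (iota 0 n).
      by rewrite has_predC all_count -/(cnt n (el i)) cnt_el ?size_iota ?neq_ltn ?hi // ltnW.
    by case/has_iotaP=> x hx h; exists x.
  by exists (Ordinal hu); rewrite /= h1.
pose f (i : 'I_n) : 'I_n := xchoose (ex i).
have fP (i : 'I_n) : el i.+1 (f i) && ~~ el i (f i) by exact: (xchooseP (ex i)).
have ltN (i : 'I_n) : i < N by apply: ltn_trans nN.
have finj : injective f.
  move=> i j; wlog lt : i j / i < j => [H E|E].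
    case: (ltngtP i j) => [lt|lt|/val_inj//]; first exact: H.
    by apply/esym; apply: H.
  have /andP[h1 _] := fP i; have /andP[_ /negP[]] := fP j; rewrite -E.
  by apply: (el_mono lt) h1 => //; apply: ltnW.
exists f; split=> //.
  move=> i u hu; have /andP[h1 h2] := fP i; apply/idP/eqP => [/andP[h3 h4]|->]; last by rewrite h1.
  exact: (@new_uniq i).
move=> v x y vx vy Ax Ay xy.
have /andP[h1 h2] := fP v.
have : simplicial v (f v).
  by move: h1; rewrite elS // (negbTE h2) => /andP[].
(* At stage [v] the vertices [f x] and [f y] are still present, since they leave later, so
   simpliciality of [f v] applies to them. *)
case/and3P=> _ _ /all_iotaP/(_ (f x) (ltN _))/all_iotaP/(_ (f y) (ltN _))/implyP; apply.
have nel (z : 'I_n) : v < z -> ~~ el v (f z).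
  move=> lt; have /andP[_] := fP z; apply: contra => h.
  by apply: el_mono h => //; apply: ltnW.
rewrite !ltn_ord !nel // Ax Ay /=; apply: contra xy => /eqP E.
by apply/eqP/finj/val_inj.
Qed.

End Elimination.

(** * Correctness of the table *)

Lemma nattau_ord n (tau : 'I_n -> int) (i : 'I_n) : nattau tau i = tau i.
Proof. by rewrite /nattau valK. Qed.

Lemma natE_ord n (e : rel 'I_n) (i j : 'I_n) : natE e i j = e i j.
Proof. by rewrite /natE !valK. Qed.

(** * From the entries of the root bag to [dyn] *)

Section Dyn.
Variables (t n N : nat) (e : rel 'I_n) (tau : 'I_n -> int) (f : 'I_n -> 'I_n).
Variables (E : rel nat) (tle : nat -> nat -> bool).
Variable G : nat -> nat -> seq nat -> seq nat -> nat -> bool.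
Hypothesis finj : injective f.
Hypothesis Ef : forall i j : 'I_n, E i j = e (f i) (f j).
Hypothesis Ebnd : forall x y, E x y -> y < n.
Hypothesis Esym : symmetric E.
Hypothesis peo : forall v x y, v < x -> v < y -> E v x -> E v y -> x != y -> E x y.
Hypothesis tau_t : forall u, (tau u <= Posz t)%R.
Hypothesis hN : n + t < N.
Hypothesis tlef : forall (i : 'I_n) b, b < N -> tle i b = (tau (f i) <= Posz b)%R.
Hypothesis Gstep : forall v j M r c, v <= n -> j <= n -> fits t N M -> fits t N r ->
  c < N -> G v j M r c = stepb t n N E tle G v j M r c.

Let tau' (u : nat) : int := nattau (fun i => tau (f i)) u.

Lemma tau'_t u : u < n -> (tau' u <= Posz t)%R.
Proof. by move=> hu; rewrite /tau' (nattau_ord _ (Ordinal hu)). Qed.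

Lemma tle_tau' u b : u < n -> b < N -> tle u b = (tau' u <= Posz b)%R.
Proof. by move=> hu hb; rewrite /tau' (nattau_ord _ (Ordinal hu)) -tlef. Qed.

(** The default is true so that a witness, a predicate on all naturals, can be included in the
    pullback without a bound; counts look only below [n]. *)
Definition pullback (X : {set 'I_n}) (x : nat) : bool :=
  if insub x is Some i then f i \in X else true.

Lemma pullback_ord X (i : 'I_n) : pullback X i = (f i \in X).
Proof. by rewrite /pullback valK. Qed.

Lemma f_surj u : exists i, u = f i.
Proof. by have [g _ gK] := injF_bij finj; exists (g u); rewrite gK. Qed.

Lemma cnt_nbhd (X : {set 'I_n}) (i : 'I_n) :
  cnt n (fun x => E i x && pullback X x) = #|nbhd e (f i) :&: X|.
Proof.
rewrite cnt_card -(card_imset _ finj); apply: eq_card => u.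
have [j ->] := f_surj u; rewrite mem_imset // !inE Ef pullback_ord.
by [].
Qed.

Lemma dp_dyn_sound M r c : fits t N M -> fits t N r -> c < N -> G n n M r c ->
  dyn e tau <= c.
Proof.
move=> fM fr hc hG.
have [_ [D [_ hfull] hD]] := dp_sound Ebnd Esym peo tau'_t hN tle_tau' Gstep
  (leqnn _) (leqnn _) fM fr hc hG.
apply: leq_trans hD; rewrite cnt_card -(card_imset _ finj); apply: dyn_min.
apply/dyn_monopolyP => X sX hX; apply/setP => u; rewrite inE.
(* The bag of the root [n] is empty, so [sem_full] infects every vertex with no condition left on
   the bag. *)
have [i ->] := f_surj u; rewrite -pullback_ord; apply: hfull.
- move=> x hx _; rewrite -[x]/(val (Ordinal hx)) cnt_nbhd pullback_ord /tau' nattau_ord.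
  exact: hX.
- move=> x hx; rewrite /pullback; case: insubP => [j _ ej|//].
  by apply: (subsetP sX); rewrite mem_imset // inE ej.
- move=> x /orP[/andP[]|/andP[_]]; first by rewrite ltnn.
  by rewrite Esym => /Ebnd; rewrite ltnn.
- by apply: W_all.
Qed.

Lemma dp_dyn_complete : exists M r, [/\ fits t N M, fits t N r & G n n M r (dyn e tau)].
Proof.
have [D hD <-] := dyn_attained e tau; have [g hg] := infection_time hD.
(* Refining the round by the rank of the vertex breaks ties and preserves strict precedence. *)
pose T (x : nat) := if insub x is Some i then g (f i) * n + (i : 'I_n) else 0.
have T_ord (i : 'I_n) : T i = g (f i) * n + i by rewrite /T valK.
have T_inj x y : x < n -> y < n -> T x = T y -> x = y.
  move=> hx hy; rewrite -[x]/(val (Ordinal hx)) -[y]/(val (Ordinal hy)) !T_ord /=.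
  by move/(congr1 (fun z => z %% n)); rewrite !modnMDl !modn_small.
have T_lt (i j : 'I_n) : g (f i) < g (f j) -> T i < T j.
  by rewrite !T_ord => h; have := ltn_ord i; nia.
pose D' := pullback D.
have hT u : u < n -> ~~ D' u ->
    (tau' u <= Posz (cnt n (fun x => E u x && (T x < T u)%N)))%R.
  move=> hu; rewrite -[u]/(val (Ordinal hu)) /D' pullback_ord /tau' nattau_ord => /hg h.
  apply: le_trans h _; rewrite lez_nat cnt_card -[X in _ <= X](card_imset _ finj).
  apply: subset_leq_card; apply/subsetP => w; have [j ->] := f_surj w.
  rewrite mem_imset // !inE => /andP[hE hlt].
  by apply/andP; split; [move: hE; rewrite -Ef | exact: (T_lt j (Ordinal hu))].
exists (slots t n E T n), (counts t n E T n n); split.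
- exact: fits_slots.
- exact: fits_counts.
have := dp_complete Ebnd Esym peo tau'_t hN tle_tau' Gstep T_inj hT (leqnn n) (leqnn n).
rewrite cnt_card; congr (is_true (G _ _ _ _ _)).
rewrite -(card_imset _ finj); apply: eq_card => u; have [i ->] := f_surj u.
by rewrite mem_imset // inE W_all //= /D' pullback_ord.
Qed.

Lemma dyn_leq : dyn e tau <= n.
Proof. by rewrite -[X in _ <= X]card_ord -cardsT; apply: dyn_min; exact: dyn_monopoly_setT. Qed.

End Dyn.

Lemma eq_exs_in k N (p q : seq nat -> bool) :
  (forall M, size M = k -> all (fun x => x < N) M -> p M = q M) ->
  exs k N p = exs k N q.
Proof.
move=> h; apply/exsP/exsP => -[M [sM aM hM]]; exists M; split=> //.
  by rewrite -h.
by rewrite h.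
Qed.

Lemma eq_has_iota N (p q : pred nat) : (forall i, i < N -> p i = q i) ->
  has p (iota 0 N) = has q (iota 0 N).
Proof. by move=> h; apply: eq_in_has => i; rewrite mem_iota => hi; apply: h; lia. Qed.

Lemma eq_all_iota N (p q : pred nat) : (forall i, i < N -> p i = q i) ->
  all p (iota 0 N) = all q (iota 0 N).
Proof. by move=> h; apply: eq_in_all => i; rewrite mem_iota => hi; apply: h; lia. Qed.

(** Since a cell sees a truncated table, agreement of [G1] and [G2] is asked only at the cells that
    are really read. The premise [parb] lets the user derive [y < v], which makes the cell with
    prefix [(y, y)] an earlier one. *)
Lemma eq_stepb t n N E tle1 tle2 G1 G2 v j M r c :
  (forall y b, y < N -> b < N -> tle1 y b = tle2 y b) ->
  (forall y r' c', j = y.+1 -> fits t N r' -> c' < N -> G1 v y M r' c' = G2 v y M r' c') ->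
  (forall y M' r' c', y < N -> j = y.+1 -> parb n N E y v -> fits t N M' -> fits t N r' -> c' < N ->
    G1 y y M' r' c' = G2 y y M' r' c') ->
  fits t N r -> c < N ->
  stepb t n N E tle1 G1 v j M r c = stepb t n N E tle2 G2 v j M r c.
Proof.
move=> ht h1 h2 fr hc; rewrite /stepb; congr (_ || _); apply: eq_has_iota => y hy.
case: (j =P y.+1) => //= hj; case hp: (parb n N E y v) => /=; last exact: h1.
rewrite !orbF.
apply: eq_exs_in => r1 s1 a1; apply: eq_exs_in => M' sM' aM'; apply: eq_exs_in => r' s' a'.
have f1 : fits t N r1 by rewrite /fits s1 eqxx.
have f2 : fits t N M' by rewrite /fits sM' eqxx.
have f3 : fits t N r' by rewrite /fits s' eqxx.
apply: eq_has_iota => c1 hc1; apply: eq_has_iota => c' hc'.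
rewrite h1 // h2 //; do 2 congr (_ && _); congr (_ && _); congr (_ || _ && _).
rewrite /doneb; congr (_ || _); apply: eq_has => i; congr (_ && _).
by apply: eq_has_iota => b hb; rewrite ht.
Qed.

(** * The table cells satisfy the intended recursions *)

Section Glue.
Variables (t : nat) (c : ctx).
Local Notation N := (cN c).
Local Notation n := (cn c).
Local Notation T := (cT c).
Hypothesis hN : N = n + (t + 5).
Hypothesis hgood : good (phi t) (arity t) c T.
Hypothesis hsize : size T = N ^ arity t.

Lemma cell_phi s : size s = arity t -> all (fun x => x < N) s ->
  cell c s = phi t (withT c (take (idx N s) T)) s.
Proof.
move=> ss hs; rewrite /cell hgood // hsize -ss; exact: idx_lt_expn.
Qed.

Lemma cell_take k s : idx N s < k -> cell (withT c (take k T)) s = cell c s.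
Proof. by move=> h; rewrite /cell /= nth_take. Qed.

Lemma size_pad : size (pad t) = t.+1 + t.+1 + 1.
Proof. exact: size_nseq. Qed.

Lemma all_pad : all (fun x => x < N) (pad t).
Proof. by rewrite /pad all_nseq; apply/orP; right; lia. Qed.

Lemma look_phi tag x y : tag < 5 -> x < N -> y < N ->
  look t tag c x y = phi t (withT c (take (idx N (tag :: x :: y :: pad t)) T))
    (tag :: x :: y :: pad t).
Proof.
move=> ht hx hy; rewrite /look cell_phi //; first by rewrite /arity -size_pad.
by apply/and4P; split=> //; [lia | exact: all_pad].
Qed.

(** Cells with a smaller tag come first, whatever their other coordinates, so the truncation keeps
    them. *)
Lemma look_take_tag tag tag' x y s : tag < tag' -> size s = (size (pad t)).+2 ->
  x < N -> y < N ->
  look t tag (withT c (take (idx N (tag' :: s)) T)) x y = look t tag c x y.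
Proof.
move=> lt ss hx hy; rewrite /look cell_take //.
by apply: (@idx_lex N [::]) => //; apply/and3P; split=> //; exact: all_pad.
Qed.

Lemma simpb_ext (T' : seq bool) r u : u < N ->
  (forall x, x < N -> look t 0 (withT c T') r x = look t 0 c r x) ->
  simpb t (withT c T') r u = simpb t c r u.
Proof.
move=> hu h; rewrite /simpb /= h //; do 2 congr (_ && _).
apply: eq_all_iota => x hx; apply: eq_all_iota => y hy.
by rewrite !h.
Qed.

Lemma look0_0 v : v < N -> look t 0 c 0 v = false.
Proof.
move=> hv; rewrite look_phi //; last by lia.
by rewrite /phi /= !orbF; apply/negbTE/hasPn.
Qed.

Lemma look0_S r v : r < n -> v < N -> look t 0 c r.+1 v = look t 0 c r v ||
  simpb t c r v && all (fun u => (u < v) ==> ~~ simpb t c r u) (iota 0 N).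
Proof.
move=> hr hv; rewrite look_phi //; last by lia.
set T' := take _ T; rewrite /phi /= !orbF.
have hl x : x < N -> look t 0 (withT c T') r x = look t 0 c r x.
  move=> hx; rewrite /look cell_take //.
  by apply: (@idx_lex N [:: 0]) => //; apply/andP; split=> //; exact: all_pad.
rewrite /elimb /=; apply/has_iotaP/idP => [[r' _ /andP[/eqP[<-]]]|h].
  rewrite hl // simpb_ext //; congr (is_true (_ || _ && _)).
  by apply: eq_all_iota => u hu; rewrite simpb_ext.
exists r; first by lia.
rewrite eqxx /= hl // simpb_ext //; move: h; congr (is_true (_ || _ && _)).
by apply: eq_all_iota => u hu; rewrite simpb_ext.
Qed.

Lemma rankb_take tag' i u s : 0 < tag' -> size s = (size (pad t)).+2 -> i < n -> u < N ->
  rankb t (withT c (take (idx N (tag' :: s)) T)) i u = rankb t c i u.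
Proof. by move=> h ss hi hu; rewrite /rankb !look_take_tag //; lia. Qed.

Lemma look1E i j : i < n -> j < n -> look t 1 c i j = edgeb t c i j.
Proof.
move=> hi hj; rewrite look_phi //; try lia.
rewrite /phi /= !orbF /edgeb /= hi hj /=.
apply: eq_has_iota => u hu; apply: eq_has_iota => w hw.
by rewrite !rankb_take.
Qed.

Lemma look2E i b : i < n -> b < N -> look t 2 c i b = threshb t c i b.
Proof.
move=> hi hb; rewrite look_phi //; try lia.
rewrite /phi /= !orbF /threshb /= hi /=.
by apply: eq_has_iota => u hu; rewrite rankb_take.
Qed.

Lemma lookG_step v j M r k : v <= n -> j <= n -> fits t N M -> fits t N r -> k < N ->
  lookG c v j M r k = stepb t n N (adjT t c) (tleT t c) (lookG c) v j M r k.
Proof.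
move=> hv hj fM fr hk.
have sz M' r' (k' : nat) : fits t N M' -> fits t N r' ->
    size (M' ++ (r' ++ [:: k'])) = t.+1 + t.+1 + 1.
  by move=> /andP[/eqP h1 _] /andP[/eqP h2 _]; rewrite !size_cat h1 h2 /=; lia.
have al M' r' k' : fits t N M' -> fits t N r' -> k' < N ->
    all (fun x => x < N) (M' ++ (r' ++ [:: k'])).
  by move=> /andP[_ h1] /andP[_ h2] h3; rewrite !all_cat h1 h2 /= h3.
set s := M ++ (r ++ [:: k]).
rewrite {1}/lookG cell_phi; last 2 first.
- by rewrite /= sz.
- by rewrite /= al //; lia.
rewrite -/s; set T' := take _ T; rewrite /phi /=.
have ss : size (v :: j :: s) = (size (pad t)).+2 by rewrite size_pad -(sz _ _ k fM fr).
have /andP[/eqP sM _] := fM; have /andP[/eqP sr _] := fr.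
have -> : take t.+1 (drop 0 s) = M by rewrite drop0 take_size_cat.
have -> : drop (0 + t.+1) s = r ++ [:: k] by rewrite add0n drop_size_cat.
rewrite take_size_cat //.
have -> : nth 0 s (0 + t.+1 + t.+1) = k.
  by rewrite add0n /s !nth_cat sM sr ltnNge leq_addr /= addKn ltnn subnn.
rewrite /stepT /=.
(* [adjT] checks its bounds, hence is the same function on both tables; [tleT] agrees only below
   [N], which [eq_stepb] allows. *)
have -> : adjT t (withT c T') = adjT t c.
  apply: FunctionalExtensionality.functional_extensionality => x.
  apply: FunctionalExtensionality.functional_extensionality => y.
  rewrite /adjT /=; case: ltnP => //= hx; case: ltnP => //= hy.
  by apply: look_take_tag => //; lia.
apply: eq_stepb => //.
- by move=> y b hy hb; apply: look_take_tag.
- move=> y r' c' hjy fr' hc'; rewrite /lookG cell_take //.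
  apply: (@idx_lex N [:: 3; v]); rewrite ?hjy ?sz ?al //.
- move=> y M' r' c' hy hjy hp fM' fr' hc'; rewrite /lookG cell_take //.
  (* For [v = n] the bound comes from [y.+1 = j] and [j <= n]. *)
  have yv : y < v.
    by case/orP: hp => [/andP[/andP[_ /andP[]]]|/andP[/eqP-> _]] //; rewrite -hjy.
  by apply: (@idx_lex N [:: 3]); rewrite //= ?sz ?al // hy.
Qed.

Variables (e : rel 'I_n) (tau : 'I_n -> int).
Hypothesis cE_e : cE c = natE e.
Hypothesis ctau_tau : ctau c = nattau tau.
Hypothesis esimple : simple_graph e.
Hypothesis einterval : interval_graph e.
Hypothesis tau_t : forall u, (tau u <= Posz t)%R.

Lemma adj_ord (i j : 'I_n) : adj c i j = e i j.
Proof.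
case: esimple => es ei; rewrite /adj cE_e !natE_ord !ltn_ord !andbT es orbC.
case: (ltngtP i j) => [||/val_inj->] //=; first by rewrite es orbF.
Qed.

Lemma adj_simplicial (S : pred nat) : (exists2 x, x < n & S x) ->
  exists2 v, v < n & S v /\ forall x y, x < n -> y < n -> S x -> S y ->
    adj c v x -> adj c v y -> x != y -> adj c x y.
Proof.
move=> [x0 hx0 Sx0]; case: esimple => es ei.
have [|v hv hsim] := @interval_simplicial _ e [set i : 'I_n | S i] einterval.
  by apply/set0Pn; exists (Ordinal hx0); rewrite inE.
rewrite inE in hv; exists v => //; split=> // x y hx hy.
rewrite -[x]/(val (Ordinal hx)) -[y]/(val (Ordinal hy)) => Sx Sy.
have ne (i j : 'I_n) : e i j -> i != j by apply: contraTneq => ->; rewrite ei.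
rewrite !adj_ord => vx vy xy; apply: (hsim _ _ _ _ (ne _ _ vx) (ne _ _ vy)) => //.
- by rewrite inE.
- by rewrite inE.
Qed.

Lemma outb_dyn u : u < N -> outb t c [:: u] = (u == dyn e tau).
Proof.
have nN : n < N by lia.
have ltN (i : 'I_n) : i < N by apply: ltn_trans nN.
have [f [finj hrank hpeo]] := elimination nN look0_0 look0_S adj_simplicial.
have rankE (i : 'I_n) w : w < N -> rankb t c i w = (w == f i :> nat) by exact: hrank.
have Ef (i j : 'I_n) : adjT t c i j = e (f i) (f j).
  rewrite /adjT !ltn_ord look1E //= /edgeb !ltn_ord /= -adj_ord.
  apply/has_iotaP/idP => [[w hw /has_iotaP[w' hw']]|h].
    by rewrite !rankE // => /and3P[/eqP-> /eqP->].
  exists (f i) => //; apply/has_iotaP; exists (f j) => //.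
  by rewrite !rankE // !eqxx.
have Ebnd x y : adjT t c x y -> y < n by case/and3P.
have Esym : symmetric (adjT t c).
  move=> x y; case: (ltnP x n) => hx; last by rewrite /adjT ltnNge hx andbF.
  case: (ltnP y n) => hy; last by rewrite /adjT [y < n]ltnNge hy andbF.
  rewrite -[x]/(val (Ordinal hx)) -[y]/(val (Ordinal hy)) !Ef.
  by case: esimple.
have peo v x y : v < x -> v < y -> adjT t c v x -> adjT t c v y -> x != y -> adjT t c x y.
  move=> vx vy hvx hvy.
  have hx := Ebnd _ _ hvx; have hy := Ebnd _ _ hvy; have hv := ltn_trans vx hx.
  move: vx vy hvx hvy.
  rewrite -[v]/(val (Ordinal hv)) -[x]/(val (Ordinal hx)) -[y]/(val (Ordinal hy)) !Ef.
  by rewrite -!adj_ord; exact: hpeo.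
have tlef (i : 'I_n) b : b < N -> tleT t c i b = (tau (f i) <= Posz b)%R.
  move=> hb; rewrite /tleT look2E // /threshb ltn_ord /= ctau_tau.
  apply/has_iotaP/idP => [[w hw]|h].
    by rewrite rankE // => /andP[/andP[/eqP-> _]]; rewrite nattau_ord.
  by exists (f i) => //; rewrite rankE // eqxx ltn_ord nattau_ord.
have hNt : n + t < N by lia.
have [M0 [r0 [fM0 fr0 hG]]] := dp_dyn_complete finj Ef Ebnd Esym peo tau_t hNt tlef lookG_step.
have ansP k : k < N -> ansb t c k -> dyn e tau <= k.
  move=> hk /exsP[M [sM aM /exsP[r [sr ar h]]]].
  apply: (dp_dyn_sound finj Ef Ebnd Esym peo tau_t hNt tlef lookG_step _ _ hk h).
    by rewrite /fits sM eqxx.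
  by rewrite /fits sr eqxx.
have ansD : ansb t c (dyn e tau).
  have /andP[/eqP s1 a1] := fM0; have /andP[/eqP s2 a2] := fr0.
  by apply/exsP; exists M0; split=> //; apply/exsP; exists r0.
have dN : dyn e tau < N by apply: leq_ltn_trans (dyn_leq _ _) nN.
move=> hu; apply/andP/eqP => [[/= h1 /all_iotaP h2]|->].
  apply/eqP; rewrite eqn_leq ansP // andbT leqNgt; apply/negP => lt.
  by have := h2 _ dN; rewrite /= lt ansD.
split=> //=; apply/all_iotaP => k hk; apply/implyP => lt.
by apply/negP => /(ansP _ hk); lia.
Qed.

End Glue.

Theorem theorem2 :
  forall t : nat,
  exists (p : seq instr) (c k : nat),
    forall (n : nat) (e : rel 'I_n) (tau : 'I_n -> int),
      simple_graph e ->
      interval_graph e ->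
      (forall u, (tau u <= t%:Z)%R) ->
      run p (c * n.+1 ^ k) 0 (encode e tau) = Some ((dyn e tau)%:Z)%R.
Proof.
move=> t.
have [p [C [k H]]] := table_machine (t + 5) (computable_phi t) (computable_out t).
exists p, C, k => n e tau he hi ht; apply: H; first by case: he.
move=> c hn hN hE htau hg hs; subst n; split.
  by apply: leq_ltn_trans (dyn_leq _ _) _; lia.
rewrite -hN in hs * => u hu.
exact: outb_dyn.
Qed.
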